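(* For all integers $r\ge2$ and $1\le d\le r-1$, $$C_{r,d}=\sum_{\substack{\nu\vdash r-1\\ \ell(\nu)=d}}C_\nu.$$ Consequently, for every $r\ge2$, $$C_r=\sum_{d=1}^{r-1}C_{r,d}.$$ Moreover, for every $r\ge2$, $C_{r,1}=\rho_r$.
   Context: For a partition $\nu$, $\ell(\nu)$ is its number of positive parts and $\nu\vdash N$ means that its parts sum to $N$. For $k,q\ge1$ put $a_k(q)=\dfrac{1}{(k+1)!\,q^k(q+1)}$. Doubly graded product: $$\mathscr H(u,y)=\prod_{q=1}^\infty\left[1+y\,\frac{q(e^{u/q}-1)-u}{u(q+1)}\right]=\prod_{q=1}^\infty\Bigl(1+y\sum_{k\ge1}a_k(q)u^k\Bigr)$$ (removable singularity at $u=0$ filled in), which converges normally on compact subsets of $\mathbb C^2$. For $r\ge2$, $1\le d\le r-1$, $C_{r,d}=[u^{r-1}y^d]\mathscr H(u,y)$ is the coefficient of $u^{r-1}y^d$ in its Taylor expansion at $(0,0)$. $C_r=[u^{r-1}]\mathcal H(u)$, where $\mathcal H(u)=\prod_{q\ge1}\frac{q}{q+1}\left(1+\frac{e^{u/q}-1}{u}\right)$. For a partition $\nu=(\nu_1,\ldots,\nu_d)\vdash r-1$ with $m_j(\nu)$ the multiplicity of the part $j$, $$C_\nu=\frac{1}{\prod_{j\ge1}m_j(\nu)!}\sum_{\substack{q_1,\ldots,q_d\ge1\\ q_a\ne q_b\ (a\ne b)}}\ \prod_{s=1}^d a_{\nu_s}(q_s).$$ $\rho_r=\dfrac1{r!}\Bigl[(-1)^r+\sum_{j=3}^{r}(-1)^{r+j}\zeta(j-1)\Bigr]$,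 with $\zeta$ the Riemann zeta function. *)

(* Defs.v *)
From HB Require Import structures.
From mathcomp Require Import all_boot all_order all_algebra.
From mathcomp Require Import finmap complex.
From mathcomp Require Import all_classical all_reals all_analysis.

Set Implicit Arguments.
Unset Strict Implicit.
Unset Printing Implicit Defensive.

Import Order.TTheory GRing.Theory Num.Theory.
Import numFieldNormedType.Exports.

Local Open Scope classical_set_scope.
Local Open Scope ring_scope.

(* Declared at type numClosedFieldType so that MathComp-Analysis equips the
   complex numbers with the topology and normed-module structure of a
   numFieldType: limits and derivatives below are complex ones. *)
Definition Cplx (R : realType) : numClosedFieldType := R[i].

Definition toC {R : realType} (x : R) : Cplx R := (x%:C)%C.

Definition expC {R : realType} (z : Cplx R) : Cplx R :=
  limn (series (fun n : nat => z ^+ n / n`!%:R : Cplx R)).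

Definition infprod {R : realType} (f : nat -> Cplx R) : Cplx R :=
  limn (fun n : nat => \prod_(1 <= q < n.+1) f q).

Definition taylor {R : realType} (f : Cplx R -> Cplx R) (n : nat) : Cplx R :=
  derive1n n f 0 / n`!%:R.

(* (1 / (n! m!)) d^n/du^n d^m/dy^m f (0, 0) *)
Definition taylor2 {R : realType} (f : Cplx R -> Cplx R -> Cplx R)
    (n m : nat) : Cplx R :=
  taylor (fun u => taylor (f u) m) n.

Definition acoef (R : realType) (k q : nat) : R :=
  (k.+1`!%:R * q%:R ^+ k * q.+1%:R)^-1.

(* At u = 0 the singularity is removed: the value is
   lim_(u -> 0) (q (e^(u/q) - 1) - u) / (u (q + 1)) = 0. *)
Definition Hterm {R : realType} (q : nat) (u : Cplx R) : Cplx R :=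
  if u == 0 then 0
  else (q%:R * (expC (u / q%:R) - 1) - u) / (u * (q%:R + 1)).

Definition Hgraded {R : realType} (u y : Cplx R) : Cplx R :=
  infprod (fun q => 1 + y * Hterm q u).

(* At u = 0 the singularity is removed: (e^(u/q) - 1) / u tends to 1 / q. *)
Definition Hfactor {R : realType} (q : nat) (u : Cplx R) : Cplx R :=
  q%:R / (q%:R + 1) *
  (1 + (if u == 0 then q%:R^-1 else (expC (u / q%:R) - 1) / u)).

Definition Hsingle {R : realType} (u : Cplx R) : Cplx R :=
  infprod (fun q => Hfactor q u).

Definition Crd (R : realType) (r d : nat) : Cplx R := taylor2 Hgraded r.-1 d.

Definition Cr (R : realType) (r : nat) : Cplx R := taylor Hsingle r.-1.

Definition is_partition (N : nat) (nu : seq nat) : bool :=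
  [&& sorted geq nu, 0%N \notin nu & sumn nu == N].

Definition distinct_pos (d : nat) : set (d.-tuple nat) :=
  [set q : d.-tuple nat | uniq q /\ (forall s : 'I_d, (1 <= tnth q s)%N)].

(* The sum over (q_1, .., q_d) has nonnegative terms, so it is taken in the
   extended reals; it is finite on partitions by Cnu_sum_fin_num below. *)
Definition Cnu_sum (R : realType) (nu : seq nat) : \bar R :=
  \esum_(q in @distinct_pos (size nu))
    (\prod_(s < size nu) acoef R (nth 0%N nu s) (tnth q s))%:E.

Definition Cnu (R : realType) (nu : seq nat) : R :=
  (\prod_(j <- undup nu) (count_mem j nu)`!)%:R^-1 * fine (Cnu_sum R nu).

(* Sum of F over the partitions of N with exactly d parts. Parts are at most N,
   so these partitions are encoded as d-tuples over 'I_N.+1. *)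
Definition partition_sum (R : realType) (N d : nat) (F : seq nat -> R) : R :=
  \sum_(nu : d.-tuple 'I_N.+1 | is_partition N (map val nu)) F (map val nu).

Definition zeta (R : realType) (k : nat) : R :=
  limn (series (fun n : nat => (n.+1%:R ^+ k)^-1 : R)).

Definition rho (R : realType) (r : nat) : R :=
  (r`!%:R)^-1 *
  ((-1) ^+ r + \sum_(3 <= j < r.+1) (-1) ^+ (r + j) * zeta R j.-1).

Section Cnu_finite.
Variable R : realType.

Lemma acoef_ge0 k q : 0 <= acoef R k q.
Proof. by rewrite /acoef invr_ge0 !mulr_ge0 ?exprn_ge0. Qed.

Lemma acoef_le k q : (0 < k)%N -> (0 < q)%N ->
  acoef R k q <= q%:R^-1 - q.+1%:R^-1.
Proof.
move=> k0 q0.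
have q0' : 0 < q%:R :> R by rewrite ltr0n.
have -> : q%:R^-1 - q.+1%:R^-1 = (q%:R * q.+1%:R)^-1 :> R.
  rewrite -[q%:R^-1]mul1r -[q.+1%:R^-1]mul1r -mulNr addf_div ?pnatr_eq0 -?lt0n//.
  by rewrite mul1r mulN1r -natrB// subSnn mul1r.
rewrite /acoef lef_pV2 ?posrE ?mulr_gt0 ?exprn_gt0 ?ltr0n ?fact_gt0//.
rewrite ler_pM2r ?ltr0n// -natrX -natrM ler_nat.
rewrite -[leqLHS]mul1n leq_mul ?fact_gt0//.
by rewrite -[leqLHS]expn1 leq_pexp2l.
Qed.

Lemma sum_acoef_le k N : (0 < k)%N ->
  \sum_(i < N) acoef R k i.+1 <= 1.
Proof.
move=> k0; apply: (@le_trans _ _ (\sum_(i < N) (i.+1%:R^-1 - i.+2%:R^-1))).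
  by apply: ler_sum => i _; exact: acoef_le.
suff -> : \sum_(i < N) (i.+1%:R^-1 - i.+2%:R^-1) = 1 - N.+1%:R^-1 :> R.
  by rewrite lerBlDr lerDl invr_ge0.
elim: N => [|N IH]; first by rewrite big_ord0 invr1 subrr.
by rewrite big_ord_recr/= IH addrA subrK.
Qed.

Lemma Cnu_sum_fin_num (nu : seq nat) : 0%N \notin nu ->
  Cnu_sum R nu \is a fin_num.
Proof.
move=> nu0; set d := size nu.
pose F (q : d.-tuple nat) : R :=
  \prod_(s < d) acoef R (nth 0%N nu s) (tnth q s).
have F0 q : 0 <= F q by apply: prodr_ge0 => s _; exact: acoef_ge0.
rewrite ge0_fin_numE; last by apply: esum_ge0 => q _; rewrite lee_fin F0.
apply: (@le_lt_trans _ _ 1%:E); last exact: ltry.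
apply: ge_ereal_sup => _ [A [finA sA] <-].
rewrite fsbig_finite//=; set X := fset_set A.
have Xpos q : q \in X -> forall s, (1 <= tnth q s)%N.
  by rewrite in_fset_set// inE => /sA[].
pose N := (\max_(q <- X) \max_(s < d) tnth q s)%N.
have leN q s : q \in X -> (tnth q s <= N)%N.
  move=> qX; rewrite /N (big_rem q)//=.
  by rewrite (leq_trans _ (leq_maxl _ _))// (leq_bigmax s).
pose g (q : d.-tuple nat) : {ffun 'I_d -> 'I_N.+1} :=
  [ffun s => inord (tnth q s).-1].
pose G (f : {ffun 'I_d -> 'I_N.+1}) : R :=
  \prod_(s < d) acoef R (nth 0%N nu s) (f s).+1.
have gE q s : q \in X -> (g q s).+1 = tnth q s.
  move=> qX; rewrite ffunE inordK ?prednK ?Xpos//.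
  by rewrite (leq_trans (leN _ _ qX)).
rewrite sumEFin lee_fin.
rewrite (_ : \sum_(q <- X) _ = \sum_(f <- map g X) G f); last first.
  rewrite big_map; apply: eq_big_seq => q qX.
  by apply: eq_bigr => s _; rewrite gE.
have umap : uniq (map g X).
  rewrite map_inj_in_uniq ?finmap.fset_uniq// => p q pX qX pq; apply: eq_from_tnth => s.
  by rewrite -gE// -[RHS]gE// pq.
apply: (@le_trans _ _ (\sum_f G f)).
  rewrite big_uniq//= [leRHS](bigID (mem (map g X)))/= lerDl.
  by apply: sumr_ge0 => f _; apply: prodr_ge0 => s _; exact: acoef_ge0.
rewrite -(bigA_distr_bigA (fun (s : 'I_d) (j : 'I_N.+1) => acoef R (nth 0%N nu s) j.+1)).
apply: prodr_ile1 => s _; rewrite sumr_ge0/=; last by move=> *; exact: acoef_ge0.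
apply: sum_acoef_le; rewrite lt0n; apply: contraNneq nu0 => <-.
by rewrite mem_nth.
Qed.

End Cnu_finite.

(* Main.v *)
Require Import Defs.
From HB Require Import structures.
From mathcomp Require Import all_boot all_order all_algebra.
From mathcomp Require Import finmap complex.
From mathcomp Require Import all_classical all_reals all_analysis.
From mathcomp Require Import ring lra.

Import Order.TTheory GRing.Theory Num.Theory.
Import numFieldNormedType.Exports.

Set Implicit Arguments.
Unset Strict Implicit.
Unset Printing Implicit Defensive.

Local Open Scope ring_scope.

(** The product H(u, y) = prod_q (1 + y h_q(u)) has factors that are affine in
    y, with h_q(u) = sum_(k >= 1) a_k(q) u^k an entire series with nonnegative
    coefficients.  Multiplying by one more factor acts on the coefficient of
    u^n y^d by an explicit recursion, so the N-th partial product has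
    coefficients [prodcoef N n d], which are nonnegative and nondecreasing in
    N.  They are bounded: at real s, t >= 0 the monomial
    [prodcoef N n d * s ^+ n * t ^+ d] is at most the whole partial product,
    which telescopes to at most exp (t exp s), since a_k(q) is at most
    (1/q - 1/(q+1)) / k!  ([prodcoef_bound]).  Hence the coefficients converge
    to some [limcoef n d] with the same bound, and dominated convergence for
    series ([tannery]) shows that for fixed u the function y |-> H(u, y) is the
    sum of the entire series with coefficients sum_n limcoef n d u^n, which
    are themselves entire in u ([Hgraded_psum]).  An entire series may be
    differentiated term by term ([derive1_psum]), so its Taylor coefficients
    at 0 are its coefficients, and C_(r,d) = limcoef (r-1) d ([Crd_limcoef]).

    The single-variable product has the factors 1 + h_q(u), so it is H(u, 1);
    applying dominated convergence to the series in u whose coefficients are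
    the finite sums over d <= n gives C_r as the sum of the C_(r,d) ([Cr_sum]).

    For d = 1 the limit is sum_q a_(r-1)(q), and the partial fraction identity
    1/(q^(k+1) (q+1)) + 1/(q^k (q+1)) = 1/q^(k+1) turns it, up to factorials,
    into an alternating sum of zeta values ([limcoef_rho]).

    The comparison with partitions takes place at finite N, where the
    sum in C_nu is restricted to pairwise distinct q_s <= N.  Letting N grow by one,
    either N + 1 is not used or it is the value of q_s for exactly one s;
    after division by the factorials of the multiplicities, the choice of s
    among equal parts disappears and the sum becomes one over the distinct
    parts j of nu ([Cnu_finS]).  Removing one part j is a bijection between
    the partitions of n with d + 1 parts that contain j and the partitions of
    n - j with d parts ([perm_rem_parts]), so the sum over partitions satisfies
    the recursion of [prodcoef] ([prodcoef_parts]); then N tends to infinity. *)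

(** * Series of complex numbers and dominated convergence *)

Section ComplexSeries.
Variable R : realType.
Implicit Types (z w : Cplx R) (x y M : R) (c : nat -> Cplx R).

(** Real-valued modulus: the order of the complex numbers is only partial,
    so estimates are carried out in [R]. *)
Definition cabs z : R := complex.Re `|z|.

Lemma toC_cabs z : toC (cabs z) = `|z|.
Proof. by apply: RRe_real; rewrite normr_real. Qed.

Lemma toC_inj : injective (@toC R).
Proof. exact: complexI. Qed.

Lemma le_toC x y : (toC x <= toC y) = (x <= y).
Proof. exact: lecR. Qed.

Lemma lt_toC x y : (toC x < toC y) = (x < y).
Proof. exact: ltcR. Qed.

Lemma toC0 : toC (0 : R) = 0. Proof. by []. Qed.
Lemma toC1 : toC (1 : R) = 1. Proof. by []. Qed.
Lemma toCD x y : toC (x + y) = toC x + toC y. Proof. exact: rmorphD. Qed.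
Lemma toCB x y : toC (x - y) = toC x - toC y. Proof. exact: rmorphB. Qed.
Lemma toCM x y : toC (x * y) = toC x * toC y. Proof. exact: rmorphM. Qed.
Lemma toCX x n : toC (x ^+ n) = toC x ^+ n. Proof. exact: rmorphXn. Qed.
Lemma toC_nat n : toC (n%:R : R) = n%:R. Proof. exact: rmorph_nat. Qed.
Lemma toCV x : toC x^-1 = (toC x)^-1. Proof. exact: fmorphV. Qed.
Lemma toC_sum I (r : seq I) P (F : I -> R) :
  toC (\sum_(i <- r | P i) F i) = \sum_(i <- r | P i) toC (F i).
Proof. exact: rmorph_sum. Qed.

Lemma cabsM z w : cabs (z * w) = cabs z * cabs w.
Proof. by apply: toC_inj; rewrite toCM !toC_cabs normrM. Qed.

Lemma cabsX z n : cabs (z ^+ n) = cabs z ^+ n.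
Proof. by apply: toC_inj; rewrite toCX !toC_cabs normrX. Qed.

Lemma cabsD z w : cabs (z + w) <= cabs z + cabs w.
Proof. by rewrite -le_toC toCD !toC_cabs ler_normD. Qed.

Lemma cabsN z : cabs (- z) = cabs z.
Proof. by apply: toC_inj; rewrite !toC_cabs normrN. Qed.

Lemma cabsV z : cabs z^-1 = (cabs z)^-1.
Proof. by apply: toC_inj; rewrite toCV !toC_cabs normfV. Qed.

Lemma cabs_ge0 z : 0 <= cabs z.
Proof. by rewrite -le_toC toC_cabs toC0. Qed.

Lemma cabs0 : cabs 0 = 0.
Proof. by apply: toC_inj; rewrite toC_cabs normr0. Qed.

Lemma cabs_toC x : cabs (toC x) = `|x|.
Proof.
wlog x0 : x / 0 <= x => [H|].
  case: (leP 0 x) => [/H//|/ltW x0]; rewrite -normrN -H ?oppr_ge0//.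
  by rewrite /toC rmorphN cabsN.
by apply: toC_inj; rewrite toC_cabs !ger0_norm// -toC0 le_toC.
Qed.

Lemma cabs_sum I (r : seq I) (P : pred I) (F : I -> Cplx R) :
  cabs (\sum_(i <- r | P i) F i) <= \sum_(i <- r | P i) cabs (F i).
Proof.
by rewrite -le_toC toC_sum toC_cabs (le_trans (ler_norm_sum _ _ _))//
  ler_sum// => i _; rewrite toC_cabs.
Qed.

Lemma cabs_ReIm z : cabs z <= `|complex.Re z| + `|complex.Im z|.
Proof.
case: z => a b.
rewrite -(cabs_toC a) -(cabs_toC b).
have -> : (a +i* b)%C = toC a + 'i%C * toC b :> Cplx R by exact: complexE.
apply: (le_trans (cabsD _ _)); rewrite lerD2l cabsM.
have -> : cabs 'i%C = 1.
  by apply: toC_inj; rewrite toC_cabs complexiE normCi toC1.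
by rewrite mul1r.
Qed.

Lemma Re_le_cabs z : `|complex.Re z| <= cabs z.
Proof. by rewrite -le_toC toC_cabs; exact: normc_ge_Re. Qed.

Lemma Im_le_cabs z : `|complex.Im z| <= cabs z.
Proof.
have -> : complex.Im z = complex.Re (- z * 'i%C)
  by rewrite ReiNIm; case: z => a b /=; rewrite opprK.
apply: (le_trans (Re_le_cabs _)); rewrite cabsM cabsN.
have -> : cabs 'i%C = 1.
  by apply: toC_inj; rewrite toC_cabs complexiE normCi toC1.
by rewrite mulr1.
Qed.

Lemma Re_sum I (r : seq I) (P : pred I) (F : I -> Cplx R) :
  complex.Re (\sum_(i <- r | P i) F i) = \sum_(i <- r | P i) complex.Re (F i).
Proof. by apply: (big_morph (@complex.Re R) (id1 := 0)) => [[? ?] [? ?]|]. Qed.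

Lemma Im_sum I (r : seq I) (P : pred I) (F : I -> Cplx R) :
  complex.Im (\sum_(i <- r | P i) F i) = \sum_(i <- r | P i) complex.Im (F i).
Proof. by apply: (big_morph (@complex.Im R) (id1 := 0)) => [[? ?] [? ?]|]. Qed.

(** A positive complex number is a positive real one, so real tolerances
    describe the complex topology. *)
Lemma cvgC_P c (l : Cplx R) :
  (c n @[n --> \oo] --> l)%classic <->
  (forall e : R, 0 < e ->
    exists N, forall n, (N <= n)%N -> cabs (l - c n) <= e).
Proof.
split=> [/cvgrPdist_le H e e0|H].
  have : 0 < toC e by rewrite -toC0 lt_toC.
  move=> /H[N _ HN]; exists N => n Nn.
  by rewrite -le_toC toC_cabs; apply: HN.
apply/cvgrPdist_le => e e0.
have eE : e = toC (complex.Re e) by rewrite /toC RRe_real// gtr0_real.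
have : 0 < complex.Re e by rewrite -lt_toC -eE.
move=> /H[N HN]; exists N => // n /HN.
by rewrite -le_toC toC_cabs -eE.
Qed.

Lemma cvg_toC (u : nat -> R) (l : R) :
  (u n @[n --> \oo] --> l)%classic -> (toC (u n) @[n --> \oo] --> toC l)%classic.
Proof.
move=> /cvgrPdist_le H; apply/cvgC_P => e /H[N _ HN]; exists N => n Nn.
by rewrite -toCB cabs_toC; exact: HN.
Qed.

Lemma limC c (l : Cplx R) : (c n @[n --> \oo] --> l)%classic -> limn c = l.
Proof. by apply: cvg_lim; exact: norm_hausdorff. Qed.

Definition csum c : Cplx R := limn (series c).

(** The form of absolute summability used throughout.  Domination by
    M / 2^n makes the tails explicit, and entire series always satisfy it. *)
Definition geo_bounded M c := forall n, cabs (c n) <= M / 2 ^+ n.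

Lemma geo_tail M k m : 0 <= M ->
  \sum_(m <= n < m + k) M / 2 ^+ n <= 2 * M / 2 ^+ m.
Proof.
move=> M0.
suff -> : \sum_(m <= n < m + k) M / 2 ^+ n = 2 * M / 2 ^+ m - 2 * M / 2 ^+ (m + k).
  by rewrite gerBl divr_ge0 ?mulr_ge0 ?exprn_ge0.
elim: k => [|k IH]; first by rewrite addn0 big_geq// subrr.
rewrite addnS big_nat_recr ?leq_addr//= IH exprS.
by field; rewrite !expf_neq0.
Qed.

Lemma geo_bounded_ge0 M c : geo_bounded M c -> 0 <= M.
Proof. by move=> /(_ 0%N); rewrite expr0 divr1; exact: le_trans (cabs_ge0 _). Qed.

Lemma cvg_geo0 M : (M / 2 ^+ n @[n --> \oo] --> (0:R))%classic.
Proof.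
rewrite (_ : (fun n => _) = geometric M (2^-1)); last first.
  by apply/funext => n /=; rewrite exprVn.
by apply: cvg_geometric; rewrite gtr0_norm ?invr_gt0// invf_lt1// ltr1n.
Qed.

Lemma geo_small M (e : R) : 0 < e -> exists m, 2 * M / 2 ^+ m <= e.
Proof.
move=> e0; have /cvgrPdist_le/(_ _ e0)[m _ /(_ m (leqnn m))] := cvg_geo0 (2 * M).
by rewrite /= sub0r normrN => /(le_trans (ler_norm _)); exists m.
Qed.

Lemma cvg_geo_real M (x : nat -> R) : (forall n, `|x n| <= M / 2 ^+ n) ->
  cvgn (series x).
Proof.
move=> xM; apply: normed_cvg.
apply: (@series_le_cvg _ _ (geometric M 2^-1)) => [n|n|n|].
- exact: normr_ge0.
- by rewrite /= exprVn (le_trans _ (xM n)).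
- by rewrite /= exprVn.
- by apply: is_cvg_geometric_series; rewrite gtr0_norm ?invr_gt0// invf_lt1// ltr1n.
Qed.

(** The real and imaginary parts are dominated by the same geometric
    sequence, so completeness of [R] gives the limit. *)
Lemma cvg_csum M c : geo_bounded M c -> (series c @ \oo --> csum c)%classic.
Proof.
move=> cM; apply/cvg_ex.
have cRe : cvgn (series (fun n => complex.Re (c n))).
  by apply: (@cvg_geo_real M) => n; exact: le_trans (Re_le_cabs _) (cM n).
have cIm : cvgn (series (fun n => complex.Im (c n))).
  by apply: (@cvg_geo_real M) => n; exact: le_trans (Im_le_cabs _) (cM n).
exists (Complex (limn (series (fun n => complex.Re (c n))))
                (limn (series (fun n => complex.Im (c n))))).
apply/cvgC_P => e e0.
have e2 : 0 < e / 2 by rewrite divr_gt0.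
have /cvgrPdist_le/(_ _ e2)[N1 _ H1] := cRe.
have /cvgrPdist_le/(_ _ e2)[N2 _ H2] := cIm.
exists (maxn N1 N2) => n; rewrite geq_max => /andP[n1 n2].
rewrite (le_trans (cabs_ReIm _))// [leRHS]splitr lerD//.
  have := H1 n n1; rewrite /= /series/= -Re_sum.
  by case: (\sum_(0 <= k < n) c k).
have := H2 n n2; rewrite /= /series/= -Im_sum.
by case: (\sum_(0 <= k < n) c k).
Qed.

Lemma csum_eq c (l : Cplx R) : (series c @ \oo --> l)%classic -> csum c = l.
Proof. exact: limC. Qed.

Lemma csum_tail M c m : geo_bounded M c ->
  cabs (csum c - \sum_(0 <= n < m) c n) <= 2 * M / 2 ^+ m.
Proof.
move=> cM; apply/ler_addgt0Pr => e e0.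
have /cvgC_P/(_ _ e0)[N HN] := cvg_csum cM.
have := HN (m + N)%N (leq_addl _ _); rewrite /series/= => H.
rewrite -[csum c](subrK (\sum_(0 <= k < m + N) c k)) -addrA addrC.
rewrite (le_trans (cabsD _ _))// lerD//.
rewrite (big_cat_nat (leq0n m) (leq_addr N m))/= addrAC subrr add0r.
apply: le_trans (geo_tail N m (geo_bounded_ge0 cM)).
by rewrite (le_trans (cabs_sum _ _ _))// ler_sum.
Qed.

Lemma cvg_fsum (K : numFieldType) (V : normedModType K) (I : eqType)
    (r : seq I) (c : nat -> I -> V) (c' : I -> V) :
  (forall i, i \in r -> (c N i @[N --> \oo] --> c' i)%classic) ->
  ((\sum_(i <- r) c N i) @[N --> \oo] --> \sum_(i <- r) c' i)%classic.
Proof.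
elim: r => [|i r IH] H.
  by under eq_fun do rewrite big_nil; rewrite big_nil; exact: cvg_cst.
under eq_fun do rewrite big_cons; rewrite big_cons.
apply: (cvgD (H i (mem_head i r))); apply: IH => j jr.
by apply: H; rewrite inE jr orbT.
Qed.

Lemma geo_bounded_lim M (c : nat -> nat -> Cplx R) (c' : nat -> Cplx R) :
  (forall N, geo_bounded M (c N)) ->
  (forall n, (c N n @[N --> \oo] --> c' n)%classic) -> geo_bounded M c'.
Proof.
move=> cM H n; apply/ler_addgt0Pr => e e0.
have /cvgC_P/(_ _ e0)[N /(_ N (leqnn N)) HN] := H n.
rewrite -[c' n](subrK (c N n)) addrC.
by rewrite (le_trans (cabsD _ _))// lerD//; exact: cM.
Qed.

(** Dominated convergence for series: up to a tail that is uniformly small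
    in N, the sums are finite. *)
Lemma tannery M (c : nat -> nat -> Cplx R) (c' : nat -> Cplx R) :
  (forall N, geo_bounded M (c N)) ->
  (forall n, (c N n @[N --> \oo] --> c' n)%classic) ->
  (csum (c N) @[N --> \oo] --> csum c')%classic.
Proof.
move=> cM H; have c'M := geo_bounded_lim cM H.
apply/cvgC_P => e e0.
have e3 : 0 < e / 3 by rewrite divr_gt0.
have [m Hm] := geo_small M e3.
have /cvgC_P/(_ _ e3)[N HN] := cvg_fsum (r:=index_iota 0 m) (fun n _ => H n).
exists N => n /HN; set s := \sum_(i <- _) _; set t := \sum_(i <- _) _ => st.
have -> : csum c' - csum (c n) = (csum c' - s) + (s - t) + - (csum (c n) - t) by ring.
have /= h1 := csum_tail m c'M; have /= h2 := csum_tail m (cM n).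
rewrite (le_trans (cabsD _ _))//.
have h3 := cabsD (csum c' - s) (s - t).
have h4 : cabs (- (csum (c n) - t)) = cabs (csum (c n) - t) by exact: cabsN.
rewrite -/s -/t in h1 h2; rewrite h4.
lra.
Qed.

End ComplexSeries.

(** * Linear operations and Cauchy products *)

Section PowerSeries.
Variable R : realType.
Implicit Types (u z w : Cplx R) (s M : R) (a b c x y : nat -> Cplx R).

Lemma csumD M M' x y : geo_bounded M x -> geo_bounded M' y ->
  csum (fun n => x n + y n) = csum x + csum y.
Proof.
move=> xM yM; apply: csum_eq.
rewrite (_ : series _ = series x \+ series y)%classic; last first.
  by apply/funext => n; rewrite /series/= big_split.
exact: (cvgD (cvg_csum xM) (cvg_csum yM)).
Qed.

Lemma csumZ M (z : Cplx R) x : geo_bounded M x ->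
  csum (fun n => z * x n) = z * csum x.
Proof.
move=> xM; apply: csum_eq.
rewrite (_ : series _ = (fun n => z * series x n)); last first.
  by apply/funext => n; rewrite /series/= mulr_sumr.
exact: (cvgM (cvg_cst z) (cvg_csum xM)).
Qed.

Lemma csum_fin m x : (forall n, (m <= n)%N -> x n = 0) ->
  csum x = \sum_(0 <= n < m) x n.
Proof.
move=> x0; apply: csum_eq; apply/cvgC_P => e e0; exists m => n mn.
rewrite /series/= (big_cat_nat (leq0n m) mn)/=.
have -> : \sum_(m <= i < n) x i = 0.
  by rewrite big_nat big1// => i /andP[/x0].
by rewrite addr0 subrr cabs0 ltW.
Qed.

Lemma geo_bounded_shift M x : geo_bounded M x -> geo_bounded M (fun n => x n.+1).
Proof.
move=> xM n; apply: (le_trans (xM _)).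
rewrite ler_wpM2l ?(geo_bounded_ge0 xM)// lef_pV2 ?posrE ?exprn_gt0//.
by rewrite ler_eXn2l// ltr1n.
Qed.

Lemma csum_recl M x : geo_bounded M x -> csum x = x 0%N + csum (fun n => x n.+1).
Proof.
move=> xM; apply: csum_eq; rewrite -(cvg_shiftS).
rewrite (_ : (fun n => _) = (fun n => x 0%N + series (fun n => x n.+1) n)).
  exact: (cvgD (cvg_cst (x 0%N)) (cvg_csum (geo_bounded_shift xM))).
by apply/funext => n; rewrite /series/= big_nat_recl.
Qed.

Lemma cabs_csum M x : geo_bounded M x -> cabs (csum x) <= 2 * M.
Proof.
by move=> /(csum_tail 0); rewrite big_geq// subr0 expr0 divr1.
Qed.

Lemma geo_bounded_sum M (r : seq nat) (x : nat -> nat -> Cplx R) :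
  (forall k, geo_bounded M (x k)) ->
  geo_bounded (M *+ size r) (fun n => \sum_(k <- r) x k n).
Proof.
move=> xM n; apply: (le_trans (cabs_sum _ _ _)).
rewrite mulrnAl; elim: r => [|k r IH]; first by rewrite big_nil.
by rewrite big_cons /= mulrS lerD// xM.
Qed.

Lemma csum_sum M (r : seq nat) (x : nat -> nat -> Cplx R) :
  (forall k, geo_bounded M (x k)) ->
  csum (fun n => \sum_(k <- r) x k n) = \sum_(k <- r) csum (x k).
Proof.
move=> xM; elim: r => [|k r IH].
  rewrite big_nil (csum_fin (m := 0)) ?big_geq// => n _; exact: big_nil.
rewrite big_cons -IH -(csumD (xM k) (geo_bounded_sum r xM)).
by congr csum; apply/funext => n; rewrite big_cons.
Qed.

Definition delay k x : nat -> Cplx R := fun n => if (k <= n)%N then x (n - k)%N else 0.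

Lemma csum_delay M k x : geo_bounded M x -> csum (delay k x) = csum x.
Proof.
move=> xM; apply: csum_eq; rewrite -(cvg_shiftn k).
rewrite (_ : (fun n => _) = series x); first exact: cvg_csum.
apply/funext => n; rewrite /series/= (big_cat_nat (leq0n k) (leq_addl n k))/=.
have -> : \sum_(0 <= i < k) delay k x i = 0.
  by rewrite big_nat big1// => i /andP[_ ik]; rewrite /delay leqNgt ik.
rewrite add0r.
rewrite -{1}[k]add0n big_addn addnK; apply: eq_bigr => i _.
by rewrite /delay leq_addl addnK.
Qed.

Definition conv x y n : Cplx R := \sum_(0 <= k < n.+1) x k * y (n - k)%N.

(** The n + 1 terms of a convolution cost a factor at most 2^n; starting
    from ratio 1/4 leaves the ratio 1/2 of [geo_bounded]. *)
Definition geo4_bounded M x := forall n, cabs (x n) <= M / 4 ^+ n.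

Lemma natr_le_expr2 n : n.+1%:R <= (2 : R) ^+ n.
Proof. by rewrite -natrX ler_nat; exact: ltn_expl. Qed.

Lemma geo4_geo M x : geo4_bounded M x -> geo_bounded M x.
Proof.
move=> xM n; apply: (le_trans (xM n)).
have M0 : 0 <= M by have := xM 0%N; rewrite expr0 divr1; exact: le_trans (cabs_ge0 _).
rewrite ler_wpM2l// lef_pV2 ?posrE ?exprn_gt0//.
by rewrite lerXn2r ?nnegrE// ler_nat.
Qed.

Lemma geo_bounded_conv M M' x y : geo4_bounded M x -> geo4_bounded M' y ->
  geo_bounded (M * M') (conv x y).
Proof.
move=> xM yM n.
have M0 := geo_bounded_ge0 (geo4_geo xM).
have M'0 := geo_bounded_ge0 (geo4_geo yM).
apply: (le_trans (cabs_sum _ _ _)).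
apply: (@le_trans _ _ (\sum_(0 <= k < n.+1) M * M' / 4 ^+ n)).
  rewrite big_nat_cond [leRHS]big_nat_cond; apply: ler_sum => k.
  rewrite andbT ltnS => /andP[_ kn].
  rewrite cabsM -{2}(subnKC kn) exprD -mulf_div.
  by rewrite ler_pM ?cabs_ge0.
rewrite sumr_const_nat subn0 -[leLHS]mulr_natl mulrCA ler_wpM2l ?mulr_ge0//.
rewrite (_ : 4 = 2 * 2 :> R); last by ring.
rewrite exprMn invfM mulrA ler_piMl ?invr_ge0 ?exprn_ge0//.
by rewrite ler_pdivrMr ?exprn_gt0// mul1r natr_le_expr2.
Qed.

(** Mertens' theorem by truncation: when x has only N nonzero terms, the
    convolution is a finite combination of delayed copies of y, and
    dominated convergence lets N tend to infinity. *)
Lemma csum_conv M M' x y : geo4_bounded M x -> geo4_bounded M' y ->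
  csum (conv x y) = csum x * csum y.
Proof.
move=> xM yM.
have M0 := geo_bounded_ge0 (geo4_geo xM).
pose xt N k := if (k < N)%N then x k else 0.
have xtM N : geo4_bounded M (xt N).
  by move=> n; rewrite /xt; case: ifP => // _; rewrite cabs0 divr_ge0 ?exprn_ge0.
have H1 : (csum (conv (xt N) y) @[N --> \oo] --> csum (conv x y))%classic.
  apply: (@tannery _ (M * M')) => [N|n]; first exact: geo_bounded_conv.
  apply/cvgC_P => e e0; exists n.+1 => N nN.
  rewrite (_ : conv x y n = conv (xt N) y n) ?subrr ?cabs0 ?ltW//.
  apply: eq_big_nat => k /andP[_ kn].
  by rewrite /xt (leq_trans kn nN).
have E N : csum (conv (xt N) y) = (series x N) * csum y.
  rewrite /series/= mulr_suml.
  (* Both sums are extended to k < max (n + 1) N, beyond which they vanish. *)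
  rewrite (_ : conv (xt N) y =
    fun n => \sum_(0 <= k < N) delay k (fun j => x k * y j) n); last first.
    apply/funext => n; rewrite /conv.
    pose m := maxn n.+1 N.
    rewrite (big_nat_widen 0 n.+1 m) ?leq_maxl// [RHS](big_nat_widen 0 N m) ?leq_maxr//.
    rewrite big_mkcond [RHS]big_mkcond; apply: eq_bigr => k _ /=.
    rewrite /xt /delay ltnS.
    by do 2 case: ifP => _ //; rewrite ?mul0r ?mulr0.
  rewrite (@csum_sum (M * M')) => [|k n]; last first.
    rewrite /delay; case: leqP => [kn|_]; last first.
      by rewrite cabs0 divr_ge0 ?exprn_ge0 ?mulr_ge0 ?(geo_bounded_ge0 (geo4_geo yM)).
    have M'0 := geo_bounded_ge0 (geo4_geo yM).
    rewrite cabsM (@le_trans _ _ (M * M' / 4 ^+ n))//.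
      by rewrite -{2}(subnKC kn) exprD -mulf_div ler_pM ?cabs_ge0.
    rewrite ler_wpM2l ?mulr_ge0// lef_pV2 ?posrE ?exprn_gt0//.
    by rewrite lerXn2r ?nnegrE// ler_nat.
  apply: eq_bigr => k _.
  have Hk : geo_bounded (cabs (x k) * M') (fun j => x k * y j).
    by move=> j; rewrite cabsM -mulrA ler_wpM2l ?cabs_ge0//; exact: geo4_geo.
  by rewrite (csum_delay k Hk) (csumZ (x k) (geo4_geo yM)).
have H2 : (csum (conv (xt N) y) @[N --> \oo] --> csum x * csum y)%classic.
  under eq_fun do rewrite E.
  exact: (cvgM (cvg_csum (geo4_geo xM)) (cvg_cst (csum y))).
by rewrite -(limC H1) (limC H2).
Qed.
End PowerSeries.

(** * Entire series and their Taylor coefficients *)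

Section Taylor.
Variable R : realType.
Implicit Types (u h z : Cplx R) (s M : R) (a b c : nat -> Cplx R).

(** Bounded terms at every radius amount to an infinite radius of
    convergence: the bound at a multiple of s gives geometric decay at s. *)
Definition entire c := forall s, 0 <= s -> exists M, forall n, cabs (c n) * s ^+ n <= M.

Definition psum c u : Cplx R := csum (fun n => c n * u ^+ n).

Lemma entire_geo4 c u : entire c -> exists M, geo4_bounded M (fun n => c n * u ^+ n).
Proof.
move=> /(_ (4 * cabs u)); rewrite mulr_ge0 ?cabs_ge0// => /(_ isT)[M HM].
exists M => n; rewrite ler_pdivlMr ?exprn_gt0// cabsM cabsX.
by have := HM n; rewrite exprMn mulrCA mulrC -mulrA [X in _ * X <= _]mulrC mulrA.
Qed.

Lemma entire_geo c u : entire c -> exists M, geo_bounded M (fun n => c n * u ^+ n).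
Proof. by move=> /(@entire_geo4 _ u)[M /geo4_geo]; exists M. Qed.

Lemma cabs_nat n : cabs (n%:R : Cplx R) = n%:R.
Proof. by rewrite -toC_nat cabs_toC ger0_norm. Qed.

Definition deriv_coef c n : Cplx R := n.+1%:R * c n.+1.

Lemma entire_deriv c : entire c -> entire (deriv_coef c).
Proof.
move=> cE s s0.
have s1 : 0 <= 2 * (s + 1) by rewrite mulr_ge0// addr_ge0.
have [M HM] := cE _ s1; exists M => n; apply: le_trans (HM n.+1).
rewrite cabsM cabs_nat [_%:R * _]mulrC -mulrA ler_wpM2l ?cabs_ge0//.
rewrite exprMn ler_pM ?exprn_ge0//.
  by rewrite (le_trans (natr_le_expr2 _ _))// ler_eXn2l// ltr1n.
rewrite (@le_trans _ _ ((s + 1) ^+ n))//.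
  by rewrite lerXn2r ?nnegrE ?addr_ge0// lerDl.
by rewrite ler_weXn2l// lerDr.
Qed.

(** Second-order remainder of a power.  The constant is crude, but growth
    of order (4 s)^n is harmless for an entire series. *)
Lemma pow_taylor2 s u h n : 1 <= s -> cabs u <= s -> cabs (u + h) <= s ->
  cabs ((u + h) ^+ n.+1 - u ^+ n.+1 - n.+1%:R * u ^+ n * h)
    <= (4 * s) ^+ n * cabs h ^+ 2.
Proof.
move=> s1 us uhs; have s0 : 0 <= s by apply: le_trans s1.
elim: n => [|n IH].
  rewrite (_ : _ - _ = 0) ?cabs0 ?mulr_ge0 ?exprn_ge0 ?cabs_ge0//.
    by rewrite mulr_ge0.
  by rewrite !expr1 expr0; ring.
(* Multiplying the previous remainder by u + h leaves a term in h^2. *)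
have -> : (u + h) ^+ n.+2 - u ^+ n.+2 - n.+2%:R * u ^+ n.+1 * h =
  (u + h) * ((u + h) ^+ n.+1 - u ^+ n.+1 - n.+1%:R * u ^+ n * h)
  + n.+1%:R * u ^+ n * h ^+ 2.
  rewrite !exprS -[n.+2%:R]natr1; set x := u ^+ n; set y := (u + h) ^+ n.
  by set k := n.+1%:R; ring.
apply: (le_trans (cabsD _ _)).
rewrite !cabsM !cabsX cabs_nat.
have h1 : cabs (u + h) * cabs ((u + h) ^+ n.+1 - u ^+ n.+1 - n.+1%:R * u ^+ n * h)
    <= s * ((4 * s) ^+ n * cabs h ^+ 2).
  by rewrite ler_pM ?cabs_ge0.
have h2 : n.+1%:R * cabs u ^+ n <= (4 * s) ^+ n * s.
  rewrite -[leLHS]mulr1 ler_pM ?mulr_ge0 ?exprn_ge0 ?cabs_ge0//.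
  rewrite exprMn ler_pM ?exprn_ge0 ?cabs_ge0//.
    rewrite (le_trans (natr_le_expr2 _ _))// lerXn2r ?nnegrE// ler_nat//.
  by rewrite lerXn2r ?nnegrE ?cabs_ge0.
have h3 : n.+1%:R * cabs u ^+ n * cabs h ^+ 2 <= (4 * s) ^+ n * s * cabs h ^+ 2.
  by rewrite ler_wpM2r ?exprn_ge0 ?cabs_ge0.
apply: (le_trans (lerD h1 h3)).
have h4 : 0 <= (4 * s) ^+ n * s * cabs h ^+ 2.
  by rewrite !mulr_ge0 ?exprn_ge0 ?cabs_ge0 ?mulr_ge0.
rewrite [leRHS](_ : _ = 4 * ((4 * s) ^+ n * s * cabs h ^+ 2)); last first.
  by rewrite [(4 * s) ^+ n.+1]exprS; ring.
rewrite (mulrCA s); lra.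
Qed.

(** Differentiability with a quadratic remainder: the constant terms
    cancel, and what is left is the series of the remainders of the powers. *)
Lemma psum_increment c u : entire c -> exists M, 0 <= M /\ forall h, cabs h <= 1 ->
  cabs (psum c (u + h) - psum c u - psum (deriv_coef c) u * h) <= M * cabs h ^+ 2.
Proof.
move=> cE; pose s := cabs u + 1.
have s1 : 1 <= s by rewrite lerDr cabs_ge0.
have s0 : 0 <= s by apply: le_trans s1.
(* 8 = 4 * 2: the growth (4 s)^n of the remainders, times the decay 2^-n. *)
have s8 : 0 <= 8 * s by rewrite mulr_ge0.
have [M HM] := cE _ s8.
have M0 : 0 <= M.
  by apply: le_trans (HM 0%N); rewrite mulr_ge0 ?cabs_ge0 ?exprn_ge0.
exists (2 * M); split; first by rewrite mulr_ge0.
move=> h h1.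
have us : cabs u <= s by rewrite lerDl.
have uhs : cabs (u + h) <= s by rewrite (le_trans (cabsD _ _))// lerD2l.
pose p n := c n.+1 * ((u + h) ^+ n.+1 - u ^+ n.+1 - n.+1%:R * u ^+ n * h).
have pM : geo_bounded (M * cabs h ^+ 2) p.
  move=> n; rewrite cabsM.
  apply: (@le_trans _ _ (cabs (c n.+1) * ((4 * s) ^+ n * cabs h ^+ 2))).
    by rewrite ler_wpM2l ?cabs_ge0// pow_taylor2.
  rewrite mulrA [leRHS]mulrAC ler_wpM2r ?exprn_ge0 ?cabs_ge0//.
  rewrite ler_pdivlMr ?exprn_gt0// -mulrA -exprMn.
  apply: le_trans (HM n.+1); rewrite ler_wpM2l ?cabs_ge0//.
  rewrite (_ : 4 * s * 2 = 8 * s); last by ring.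
  by rewrite ler_weXn2l//; lra.
have [M1 H1] := entire_geo (u + h) cE.
have [M2 H2] := entire_geo u cE.
have [M3 H3] := entire_geo u (entire_deriv cE).
have -> : psum c (u + h) - psum c u - psum (deriv_coef c) u * h = csum p.
  rewrite /psum (csum_recl H1) (csum_recl H2) !expr0.
  have S1 := geo_bounded_shift H1; have S2 := geo_bounded_shift H2.
  have E1 := csumZ (- h) H3.
  have E2 := csumZ (-1) S2.
  have B3 : geo_bounded (cabs (- h) * M3) (fun n => - h * (deriv_coef c n * u ^+ n)).
    by move=> n; rewrite cabsM -mulrA ler_wpM2l ?cabs_ge0.
  have B2 : geo_bounded M2 (fun n => -1 * (c n.+1 * u ^+ n.+1)).
    by move=> n; rewrite mulN1r cabsN.
  have B23 : geo_bounded (M2 + cabs (- h) * M3)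
    (fun n => -1 * (c n.+1 * u ^+ n.+1) + - h * (deriv_coef c n * u ^+ n)).
    by move=> n; rewrite (le_trans (cabsD _ _))// mulrDl lerD.
  have := csumD S1 B23; rewrite (csumD B2 B3) E1 E2 => E.
  transitivity (csum (fun n => c n.+1 * (u + h) ^+ n.+1) +
    (-1 * csum (fun n => c n.+1 * u ^+ n.+1) +
    - h * csum (fun n => deriv_coef c n * u ^+ n))).
    have arith (a0 a1 b1 d k : Cplx R) :
      a0 * 1 + a1 - (a0 * 1 + b1) - d * k = a1 + (-1 * b1 + - k * d) by ring.
    exact: arith.
  rewrite -E; congr csum; apply/funext => n.
  by rewrite /deriv_coef /p; ring.
by rewrite -mulrA; exact: cabs_csum.
Qed.

Lemma derive1_psum c : entire c -> derive1 (psum c) = psum (deriv_coef c).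
Proof.
move=> cE; apply/funext => u; rewrite /derive1.
apply: cvg_lim; first exact: norm_hausdorff.
have [M [M0 HM]] := psum_increment u cE.
apply/cvgrPdist_le => e e0.
have eE : e = toC (complex.Re e) by rewrite /toC RRe_real// gtr0_real.
set r := complex.Re e in eE.
have r0 : 0 < r by rewrite -lt_toC -eE.
(* The denominator M + 1 avoids a case distinction on M = 0. *)
have d0 : 0 < Num.min 1 (r / (M + 1)).
  by rewrite lt_min ltr01 divr_gt0// ltr_wpDl.
have dC : 0 < toC (Num.min 1 (r / (M + 1))) by rewrite -toC0 lt_toC.
rewrite /dnbhs /within /=.
have := nbhsx_ballx (0 : Cplx R) _ dC; apply: filterS => h.
rewrite -ball_normE /= sub0r normrN -toC_cabs lt_toC lt_min => /andP[h1 hr] hN0.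
rewrite eE -toC_cabs le_toC.
have := HM h (ltW h1); rewrite [u + h]addrC.
have cN0 : cabs h != 0.
  by apply: contra hN0 => /eqP H; rewrite -normr_eq0 -toC_cabs H.
have c0 : 0 < cabs h by rewrite lt_neqAle eq_sym cN0 cabs_ge0.
set A := psum c _ ; set B := psum c _; set D := psum _ _ => HA.
have arith (k a b d : Cplx R) : k != 0 -> d - k^-1 * (a - b) = - k^-1 * (a - b - d * k).
  by move=> k0; field.
rewrite [X in cabs X](arith h A B D hN0) {arith}.
rewrite cabsM cabsN cabsV mulrC ler_pdivrMr//.
rewrite (le_trans HA)// expr2 mulrA ler_wpM2r ?cabs_ge0//.
rewrite (@le_trans _ _ ((M + 1) * cabs h))//.
  by rewrite ler_wpM2r ?cabs_ge0// lerDl.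
by rewrite mulrC -ler_pdivlMr ?ltr_wpDl// ltW.
Qed.

Lemma psum0 c : psum c 0 = c 0%N.
Proof.
rewrite /psum (csum_fin (m := 1)); last by case=> // n _; rewrite expr0n mulr0.
by rewrite big_nat1 expr0 mulr1.
Qed.

(** Each derivative is again an entire series, and at 0 only the constant
    term survives, so the claim follows by differentiating the series. *)
Lemma taylor_psum c n : entire c -> taylor (psum c) n = c n.
Proof.
move=> cE; rewrite /taylor.
suff -> : derive1n n (psum c) 0 = n`!%:R * c n.
  by rewrite mulrAC divff ?mul1r// pnatr_eq0 -lt0n fact_gt0.
elim: n c cE => [|n IH] c cE; first by rewrite derive1n0 psum0 mul1r.
rewrite derive1Sn derive1_psum// IH; last exact: entire_deriv.
by rewrite /deriv_coef mulrA -natrM mulnC -factS.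
Qed.

End Taylor.

(** * Coefficients of the partial products *)

Section GradedProduct.
Variable R : realType.
Implicit Types (u y : Cplx R) (s t : R).

(** Coefficient of u^n y^d in prod_(1 <= q <= N) (1 + y sum_k a_k(q) u^k):
    the new factor either contributes 1, or y and some power u^k. *)
Fixpoint prodcoef (N n d : nat) : R :=
  if N is N'.+1 then
    prodcoef N' n d +
    (if d is d'.+1 then
       \sum_(1 <= k < n.+1) acoef R k N * prodcoef N' (n - k) d'
     else 0)
  else ((n == 0%N) && (d == 0%N))%:R.

Lemma prodcoef_ge0 N n d : 0 <= prodcoef N n d.
Proof.
elim: N n d => [|N IH] n d /=; first by rewrite ler0n.
rewrite addr_ge0//; case: d => // d.
by apply: sumr_ge0 => k _; rewrite mulr_ge0 ?acoef_ge0.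
Qed.

Lemma prodcoef_nondecreasing n d : nondecreasing_seq (fun N => prodcoef N n d).
Proof.
apply/nondecreasing_seqP => N /=; rewrite lerDl; case: d => // d.
by apply: sumr_ge0 => k _; rewrite mulr_ge0 ?acoef_ge0 ?prodcoef_ge0.
Qed.

Lemma prodcoef_small_weight N n d : (n < d)%N -> prodcoef N n d = 0.
Proof.
elim: N n d => [|N IH] n [|d]//= nd; first by rewrite andbF.
rewrite IH// add0r big_nat big1// => k /andP[k1 kn].
by rewrite IH ?mulr0// ltn_subLR// (leq_trans nd)// -addn1 addnC leq_add2r.
Qed.

Lemma prodcoef_few_factors N n d : (N < d)%N -> prodcoef N n d = 0.
Proof.
elim: N n d => [|N IH] n [|d]//= nd; first by rewrite andbF.
by rewrite IH 1?ltnW// add0r big1// => k _; rewrite IH ?mulr0.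
Qed.

Lemma prodcoef_deg0 N n : prodcoef N n 0 = (n == 0%N)%:R.
Proof. by elim: N => [|N /= ->]; rewrite /= ?andbT ?addr0. Qed.

Lemma acoef_le_fact k q : (0 < k)%N -> (0 < q)%N ->
  acoef R k q <= (q%:R^-1 - q.+1%:R^-1) / k`!%:R.
Proof.
move=> k0 q0; have q0' : 0 < q%:R :> R by rewrite ltr0n.
have -> : q%:R^-1 - q.+1%:R^-1 = (q%:R * q.+1%:R)^-1 :> R.
  have qS : q%:R + 1 != 0 :> R by rewrite natr1 pnatr_eq0.
  have qN : q%:R != 0 :> R by rewrite gt_eqF.
  rewrite -[q.+1%:R]natr1; field.
  by rewrite qN qS.
rewrite -invfM /acoef lef_pV2 ?posrE ?mulr_gt0 ?exprn_gt0 ?ltr0n ?fact_gt0//.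
rewrite -natrX -!natrM ler_nat.
have H : (q * k`! <= k.+1`! * q ^ k)%N.
  rewrite mulnC leq_mul ?leq_fact//.
  by rewrite -{1}[q]expn1 leq_pexp2l.
by have := leq_mul H (leqnn q.+1); rewrite (mulnAC q k`!) // (mulnC (q * _) k`!).
Qed.

Lemma sum_exp_le s n : 0 <= s -> \sum_(0 <= k < n) s ^+ k / k`!%:R <= expR s.
Proof.
move=> s0.
have := nondecreasing_cvgn_le _ (is_cvg_series_exp_coeff s) n.
by apply; apply/nondecreasing_seqP => m; rewrite /series/= big_nat_recr//= lerDl exp_coeff_ge0.
Qed.

(** The factor 1/q - 1/(q+1) makes the product over q telescope below. *)
Lemma sum_acoef_exp s q n : 0 <= s -> (0 < q)%N ->
  \sum_(1 <= k < n.+1) acoef R k q * s ^+ k <= (q%:R^-1 - q.+1%:R^-1) * expR s.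
Proof.
move=> s0 q0.
have D0 : 0 <= q%:R^-1 - q.+1%:R^-1 :> R.
  by rewrite subr_ge0 lef_pV2 ?posrE ?ltr0n// ler_nat.
apply: (le_trans _ (ler_wpM2l D0 (sum_exp_le n.+1 s0))).
rewrite [in leRHS]big_ltn// mulrDr addrC ler_wpDr ?mulr_ge0//.
rewrite mulr_sumr big_nat [leRHS]big_nat; apply: ler_sum => k /andP[k1 _].
rewrite [in leRHS](mulrC (s ^+ k)) mulrA ler_wpM2r ?exprn_ge0//.
exact: acoef_le_fact.
Qed.

(** A single monomial is bounded by the product of the values of the
    factors, each at most 1 + t exp s (1/q - 1/(q+1)).  The induction carries
    the telescoped form of that product. *)
Lemma prodcoef_bound N n d s t : 0 <= s -> 0 <= t ->
  prodcoef N n d * s ^+ n * t ^+ d <= expR (t * expR s).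
Proof.
move=> s0 t0.
have K0 : 0 <= t * expR s by rewrite mulr_ge0// expR_ge0.
suff H : prodcoef N n d * s ^+ n * t ^+ d <= expR (t * expR s * (1 - N.+1%:R^-1)).
  by apply: (le_trans H); rewrite ler_expR ler_piMr// gerBl.
elim: N n d => [|N IH] n d.
  rewrite invr1 subrr mulr0 expR0 /=; case: n => [|n]; last by rewrite !mul0r.
  by case: d => [|d]; rewrite ?mul0r// !expr0 !mulr1.
set B := expR _ in IH.
pose D : R := N.+1%:R^-1 - N.+2%:R^-1.
have -> : t * expR s * (1 - N.+2%:R^-1) = t * expR s * (1 - N.+1%:R^-1) + t * expR s * D.
  by rewrite /D; ring.
rewrite expRD -/B.
have B0 : 0 <= B by exact: expR_ge0.
apply: (@le_trans _ _ (B * (1 + t * expR s * D))); last first.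
  by rewrite ler_wpM2l// expR_ge1Dx.
rewrite mulrDr mulr1 /= !mulrDl lerD//.
case: d => [|d]; first by rewrite !mul0r !mulr_ge0// subr_ge0 lef_pV2 ?posrE ?ltr0n// ler_nat.
apply: (@le_trans _ _ (B * (t * \sum_(1 <= k < n.+1) acoef R k N.+1 * s ^+ k))); last first.
  by rewrite ler_wpM2l// -mulrA ler_wpM2l// mulrC sum_acoef_exp.
rewrite -mulrA mulr_suml !mulr_sumr big_nat [leRHS]big_nat.
apply: ler_sum => k /andP[k1 kn].
rewrite [leLHS](_ : _ = (acoef R k N.+1 * s ^+ k * t) *
   (prodcoef N (n - k) d * s ^+ (n - k) * t ^+ d)); last first.
  rewrite -{2}(subnKC (_ : k <= n)%N)// exprD exprS; ring.
rewrite [leRHS](_ : _ = (acoef R k N.+1 * s ^+ k * t) * B); last by ring.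
by rewrite ler_wpM2l// !mulr_ge0// ?acoef_ge0 ?exprn_ge0.
Qed.

Definition limcoef n d : R := limn (fun N => prodcoef N n d).

Lemma cvg_prodcoef n d : (prodcoef N n d @[N --> \oo] --> limcoef n d)%classic.
Proof.
apply: nondecreasing_is_cvgn; first exact: prodcoef_nondecreasing.
exists (expR (1 * expR 1)) => _ [N _ <-].
have := prodcoef_bound N n d (ler01 : (0:R) <= 1) (ler01 : (0:R) <= 1).
by rewrite !expr1n !mulr1.
Qed.

Lemma limcoef_ge0 n d : 0 <= limcoef n d.
Proof.
apply: limr_ge; first exact: (cvgP _ (@cvg_prodcoef n d)).
by near=> N; exact: prodcoef_ge0.
Unshelve. all: by end_near. Qed.

Lemma limcoef_bound n d s t : 0 <= s -> 0 <= t ->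
  limcoef n d * s ^+ n * t ^+ d <= expR (t * expR s).
Proof.
move=> s0 t0.
have H : (prodcoef N n d * s ^+ n * t ^+ d @[N --> \oo] -->
   limcoef n d * s ^+ n * t ^+ d)%classic.
  by apply: cvgMl; apply: cvgMl; exact: cvg_prodcoef.
rewrite -(cvg_lim (@Rhausdorff R) H); apply: limr_le; first exact: (cvgP _ H).
by near=> N; exact: prodcoef_bound.
Unshelve. all: by end_near. Qed.

End GradedProduct.

(** * Taylor expansion of the two infinite products *)

Section Product.
Variable R : realType.
Implicit Types (u y : Cplx R) (s t : R).

Definition ucol (p : nat -> nat -> R) (d : nat) : nat -> Cplx R :=
  fun n => toC (p n d).

(** What the partial products and their limit share; every summability
    statement about either one comes from this bound. *)
Definition exp_bounded (p : nat -> nat -> R) :=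
  (forall n d, 0 <= p n d) /\
  (forall n d s t, 0 <= s -> 0 <= t -> p n d * s ^+ n * t ^+ d <= expR (t * expR s)).

Lemma exp_bounded_prodcoef N : exp_bounded (prodcoef R N).
Proof. by split=> *; [exact: prodcoef_ge0 | exact: prodcoef_bound]. Qed.

Lemma exp_bounded_limcoef : exp_bounded (limcoef R).
Proof. by split=> *; [exact: limcoef_ge0 | exact: limcoef_bound]. Qed.

Lemma entire_ucol p d : exp_bounded p -> entire (ucol p d).
Proof.
move=> [p0 pM] s s0; exists (expR (1 * expR s)) => n.
by rewrite cabs_toC ger0_norm//; have := pM n d s 1 s0 ler01; rewrite expr1n mulr1.
Qed.

(** Evaluating the bound at twice the modulus of u yields the geometric
    decay in n, while the factor t^d is kept for summing over d. *)
Lemma geo_ucol p d u t : exp_bounded p -> 0 <= t ->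
  geo_bounded (expR (t * expR (2 * cabs u)))
    (fun n => toC (t ^+ d) * (ucol p d n * u ^+ n)).
Proof.
move=> [p0 pM] t0 n; rewrite ler_pdivlMr ?exprn_gt0//.
rewrite !cabsM cabsX !cabs_toC !ger0_norm ?exprn_ge0//.
have u0 : 0 <= 2 * cabs u by rewrite mulr_ge0 ?cabs_ge0.
by have := pM n d _ _ u0 t0; rewrite exprMn; apply: le_trans;
  rewrite le_eqVlt; apply/orP; left; apply/eqP; ring.
Qed.

Lemma cabs_ucol p d u t : exp_bounded p -> 0 <= t ->
  cabs (psum (ucol p d) u) * t ^+ d <= 2 * expR (t * expR (2 * cabs u)).
Proof.
move=> pB t0; have [M HM] := entire_geo u (entire_ucol d pB).
have := cabs_csum (geo_ucol d u pB t0).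
by rewrite (csumZ _ HM) cabsM cabs_toC ger0_norm ?exprn_ge0// mulrC.
Qed.

Lemma entire_row p u : exp_bounded p -> entire (fun d => psum (ucol p d) u).
Proof. by move=> pB t t0; eexists => d; exact: cabs_ucol. Qed.

Definition hcoef q k : Cplx R := if k == 0%N then 0 else toC (acoef R k q).

Lemma entire_hcoef q : (0 < q)%N -> entire (hcoef q).
Proof.
move=> q0 s s0; exists (expR s) => -[|k]; first by rewrite cabs0 mul0r expR_ge0.
rewrite cabs_toC ger0_norm ?acoef_ge0//.
apply: (le_trans _ (sum_exp_le k.+2 s0)).
rewrite big_nat_recr//= -[leLHS]add0r lerD//.
  by apply: sumr_ge0 => i _; rewrite divr_ge0 ?exprn_ge0.
rewrite mulrC ler_wpM2l ?exprn_ge0//.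
apply: (le_trans (acoef_le_fact _ _ q0)) => //.
rewrite ler_piMl// lerBlDr (@le_trans _ _ 1)//; last by rewrite lerDl.
by rewrite invf_le1 ?ler1n ?ltr0n.
Qed.

Lemma entire_exp : entire (fun n => (n`!%:R)^-1 : Cplx R).
Proof.
move=> s s0; exists (expR s) => n.
rewrite -toC_nat -toCV cabs_toC ger0_norm//.
apply: (le_trans _ (sum_exp_le n.+1 s0)).
rewrite big_nat_recr//= mulrC -[leLHS]add0r lerD//.
by apply: sumr_ge0 => i _; rewrite divr_ge0 ?exprn_ge0.
Qed.

Lemma expC_psum u : expC u = psum (fun n => (n`!%:R)^-1) u.
Proof.
by rewrite /expC /psum /csum; congr (limn (series _)); apply/funext => n; rewrite mulrC.
Qed.

Lemma Hterm_psum q u : (0 < q)%N -> Hterm q u = psum (hcoef q) u.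
Proof.
move=> q0; rewrite /Hterm; have [->|u0] := eqVneq u 0; first by rewrite psum0.
have qN0 : q%:R != 0 :> Cplx R by rewrite pnatr_eq0 -lt0n.
have q1N0 : q%:R + 1 != 0 :> Cplx R by rewrite natr1 pnatr_eq0.
have [M HM] := entire_geo (u / q%:R) entire_exp.
have [M' HM'] := entire_geo u (entire_hcoef q0).
rewrite expC_psum /psum (csum_recl HM) (csum_recl (geo_bounded_shift HM)).
rewrite (csum_recl HM') /= mul0r add0r.
have -> : csum (fun n => (n.+2`!%:R)^-1 * (u / q%:R) ^+ n.+2) =
  u * (q%:R + 1) / q%:R * csum (fun n => hcoef q n.+1 * u ^+ n.+1).
  rewrite -(csumZ _ (geo_bounded_shift HM')); congr csum; apply/funext => n.
  rewrite /hcoef /= /acoef toCV !toCM toCX !toC_nat.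
  have f0 : n.+2`!%:R != 0 :> Cplx R by rewrite pnatr_eq0 -lt0n fact_gt0.
  rewrite -[q.+1%:R]natr1; set Q := q%:R; set F := _%:R in f0 *.
  rewrite exprMn exprVn !exprS.
  have e0 : Q ^+ n != 0 by rewrite expf_neq0.
  by field; rewrite f0 e0 qN0 q1N0.
rewrite fact0 factS fact0 !invr1 expr0 expr1.
move: (csum _) => S; field; rewrite ?qN0 ?q1N0 ?u0//.
Qed.

(** The recursion defining the coefficients is a Cauchy product. *)
Lemma psum_prodcoefS N d u :
  psum (ucol (prodcoef R N.+1) d.+1) u =
  psum (ucol (prodcoef R N) d.+1) u + Hterm N.+1 u * psum (ucol (prodcoef R N) d) u.
Proof.
have pB := exp_bounded_prodcoef N.
have [M1 H1] := entire_geo u (entire_ucol d.+1 pB).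
have [M2 H2] := entire_geo4 u (entire_ucol d pB).
have [M3 H3] := entire_geo4 u (entire_hcoef (ltn0Sn N)).
rewrite Hterm_psum// /psum -(csum_conv H3 H2) -(csumD H1 (geo_bounded_conv H3 H2)).
congr csum; apply/funext => n.
rewrite /ucol /= toCD mulrDl; congr (_ + _).
rewrite /conv [RHS]big_ltn// /hcoef /= !mul0r add0r toC_sum mulr_suml.
apply: eq_big_nat => k /andP[k0 kn]; rewrite gtn_eqF//.
by rewrite toCM -{2}(subnKC (_ : k <= n)%N)// exprD; ring.
Qed.

Lemma psum_prodcoef0 N u : psum (ucol (prodcoef R N) 0) u = 1.
Proof.
rewrite /psum (csum_fin (m := 1)).
  by rewrite big_nat1 /ucol prodcoef_deg0 expr0 mulr1.
by case=> // n _; rewrite /ucol prodcoef_deg0 toC0 mul0r.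
Qed.

(** The number m of terms is left free because adding a factor shifts d
    by one; columns beyond N vanish. *)
Lemma prod_Hterm N m u y : (N < m)%N ->
  \prod_(1 <= q < N.+1) (1 + y * Hterm q u) =
  \sum_(0 <= d < m) psum (ucol (prodcoef R N) d) u * y ^+ d.
Proof.
elim: N m => [|N IH] [//|m] Nm.
  rewrite big_geq// big_nat_recl// psum_prodcoef0 mulr1 big1 ?addr0// => d _.
  rewrite /psum (csum_fin (m := 0)) ?big_geq ?mul0r// => n _.
  by rewrite /ucol /= andbF toC0 mul0r.
rewrite [LHS](_ : _ = \prod_(1 <= q < N.+1) (1 + y * Hterm q u) *
  (1 + y * Hterm N.+1 u)); last by rewrite big_nat_recr.
rewrite (IH m.+1) 1?ltnW//.
rewrite mulrDr mulr1 !big_nat_recl// !psum_prodcoef0 !mulr1 -addrA; congr (_ + _).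
rewrite [RHS](eq_bigr (fun d => psum (ucol (prodcoef R N) d.+1) u * y ^+ d.+1 +
  Hterm N.+1 u * psum (ucol (prodcoef R N) d) u * y ^+ d.+1)); last first.
  by move=> d _; rewrite psum_prodcoefS mulrDl.
rewrite big_split /=; congr (_ + _).
have := IH m.+1 (ltnW Nm); rewrite [RHS]big_nat_recl// psum_prodcoef0 mulr1 => <-.
rewrite (IH m Nm) mulr_suml; apply: eq_bigr => d _; rewrite exprS; ring.
Qed.

Lemma cvg_psum_prodcoef d u :
  (psum (ucol (prodcoef R N) d) u @[N --> \oo] --> psum (ucol (limcoef R) d) u)%classic.
Proof.
apply: (@tannery _ (expR (1 * expR (2 * cabs u)))) => [N|n].
  have := geo_ucol d u (exp_bounded_prodcoef N) ler01.
  by rewrite expr1n; under eq_fun do rewrite mul1r.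
apply: cvgM; last exact: cvg_cst.
by apply: cvg_toC; exact: cvg_prodcoef.
Qed.

(** Two limits are exchanged with sums: in n within each column, then in d,
    where [cabs_ucol] provides the domination. *)
Lemma Hgraded_psum u y : Hgraded u y = psum (fun d => psum (ucol (limcoef R) d) u) y.
Proof.
apply: limC.
rewrite (_ : (fun N => _) = (fun N => psum (fun d => psum (ucol (prodcoef R N) d) u) y)).
  pose M := 2 * expR (2 * cabs y * expR (2 * cabs u)).
  apply: (@tannery _ M) => [N d|d].
    rewrite cabsM cabsX ler_pdivlMr ?exprn_gt0// -mulrA -exprMn [cabs y * 2]mulrC.
    by apply: cabs_ucol; [exact: exp_bounded_prodcoef | rewrite mulr_ge0 ?cabs_ge0].
  apply: cvgM; last exact: cvg_cst.
  exact: cvg_psum_prodcoef.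
apply/funext => N; rewrite (prod_Hterm u y (ltnSn N)).
rewrite [RHS](csum_fin (m := N.+1))// => d Nd.
rewrite [X in X * _](csum_fin (m := 0)) ?big_geq ?mul0r// => n _.
by rewrite /ucol prodcoef_few_factors// toC0 mul0r.
Qed.

Lemma Crd_limcoef r d : Crd R r d = toC (limcoef R r.-1 d).
Proof.
rewrite /Crd /taylor2.
rewrite (_ : (fun u => taylor (Hgraded u) d) = psum (ucol (limcoef R) d)).
  by rewrite taylor_psum//; exact: entire_ucol exp_bounded_limcoef.
apply/funext => u.
rewrite (_ : Hgraded u = psum (fun d => psum (ucol (limcoef R) d) u)); last first.
  by apply/funext => y; exact: Hgraded_psum.
by rewrite taylor_psum//; exact: entire_row exp_bounded_limcoef.
Qed.

(** So the single-variable product is the graded one at y = 1. *)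
Lemma Hfactor_Hterm q u : (0 < q)%N -> Hfactor q u = 1 + Hterm q u.
Proof.
move=> q0; rewrite /Hfactor /Hterm.
have qN0 : q%:R != 0 :> Cplx R by rewrite pnatr_eq0 -lt0n.
have q1N0 : q%:R + 1 != 0 :> Cplx R by rewrite natr1 pnatr_eq0.
have [_|u0] := eqVneq u 0; first by field; rewrite qN0 q1N0.
by move: (expC _) => E; field; rewrite u0 q1N0.
Qed.

(** Summing over d <= n only is enough, because every factor y comes with
    at least one factor u. *)
Definition rowsum (p : nat -> nat -> R) n : Cplx R :=
  \sum_(0 <= d < n.+1) toC (p n d).

(** The n + 1 summands are absorbed by evaluating the bound at four times
    the modulus of u. *)
Lemma geo_rowsum p u : exp_bounded p ->
  geo_bounded (expR (1 * expR (4 * cabs u))) (fun n => rowsum p n * u ^+ n).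
Proof.
move=> [p0 pM] n; set B := expR _.
have u0 : 0 <= 4 * cabs u by rewrite mulr_ge0 ?cabs_ge0.
have H d : cabs (toC (p n d)) * cabs u ^+ n <= B / 4 ^+ n.
  rewrite cabs_toC ger0_norm// ler_pdivlMr ?exprn_gt0// -mulrA -exprMn.
  by rewrite [cabs u * 4]mulrC; have := pM n d _ _ u0 ler01; rewrite expr1n mulr1.
rewrite cabsM cabsX (@le_trans _ _ (\sum_(0 <= d < n.+1) B / 4 ^+ n))//.
  rewrite (@le_trans _ _ ((\sum_(0 <= d < n.+1) cabs (toC (p n d))) * cabs u ^+ n))//.
    by rewrite ler_wpM2r ?exprn_ge0 ?cabs_ge0// cabs_sum.
  by rewrite mulr_suml ler_sum.
rewrite sumr_const_nat subn0 -[leLHS]mulr_natl mulrCA ler_wpM2l ?expR_ge0//.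
rewrite (_ : 4 = 2 * 2 :> R); last by ring.
rewrite exprMn invfM mulrA ler_piMl ?invr_ge0 ?exprn_ge0//.
by rewrite ler_pdivrMr ?exprn_gt0// mul1r natr_le_expr2.
Qed.

Lemma entire_rowsum p : exp_bounded p -> entire (rowsum p).
Proof.
move=> pB s s0; exists (expR (1 * expR (4 * s))) => n.
have := geo_rowsum (toC s) pB n; rewrite cabsM cabsX cabs_toC ger0_norm//.
move=> /le_trans; apply.
by rewrite ler_piMr ?expR_ge0// invf_le1 ?exprn_gt0// -natrX ler1n expn_gt0.
Qed.

Lemma Hsingle_psum u : Hsingle u = psum (rowsum (limcoef R)) u.
Proof.
apply: limC.
rewrite (_ : (fun N => _) = (fun N => psum (rowsum (prodcoef R N)) u)).
  apply: (@tannery _ (expR (1 * expR (4 * cabs u)))) => [N|n].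
    exact: geo_rowsum (exp_bounded_prodcoef N).
  apply: cvgM; last exact: cvg_cst.
  by apply: cvg_fsum => d _; apply: cvg_toC; exact: cvg_prodcoef.
apply/funext => N.
have := prod_Hterm u 1 (ltnSn N).
rewrite (_ : \prod_(1 <= q < N.+1) _ = \prod_(1 <= q < N.+1) Hfactor q u); last first.
  by apply: eq_big_nat => q /andP[q0 _]; rewrite mul1r Hfactor_Hterm.
move=> ->.
transitivity (\sum_(0 <= d < N.+1) psum (ucol (prodcoef R N) d) u).
  by apply: eq_bigr => d _; rewrite expr1n mulr1.
have pB := exp_bounded_prodcoef N.
rewrite -(csum_sum (M := expR (1 * expR (2 * cabs u)))); last first.
  move=> d; have := geo_ucol d u pB ler01.
  by rewrite expr1n; under eq_fun do rewrite mul1r.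
congr csum; apply/funext => n.
rewrite -mulr_suml /rowsum; congr (_ * _).
pose m := maxn n.+1 N.+1.
rewrite (big_nat_widen 0 N.+1 m) ?leq_maxr// [RHS](big_nat_widen 0 n.+1 m) ?leq_maxl//.
rewrite big_mkcond [RHS]big_mkcond; apply: eq_bigr => d _ /=.
rewrite !ltnS /ucol; case: leqP => dN; case: leqP => dn //.
  by rewrite prodcoef_small_weight.
by rewrite prodcoef_few_factors.
Qed.

Lemma limcoef_deg0 n : (0 < n)%N -> limcoef R n 0 = 0.
Proof.
move=> n0; rewrite /limcoef.
under eq_fun do rewrite prodcoef_deg0 gtn_eqF//.
exact: lim_cst.
Qed.

Lemma Cr_sum r : (2 <= r)%N -> Cr R r = \sum_(1 <= d < r) Crd R r d.
Proof.
case: r => [|[|r]]// _; rewrite /Cr.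
rewrite (_ : Hsingle = psum (rowsum (limcoef R))); last first.
  by apply/funext => u; exact: Hsingle_psum.
rewrite taylor_psum; last exact: entire_rowsum exp_bounded_limcoef.
rewrite /rowsum /= big_ltn// limcoef_deg0// add0r.
by apply: eq_bigr => d _; rewrite Crd_limcoef.
Qed.
End Product.

(** * One factor: zeta values *)

Section Rho.
Variable R : realType.

Lemma prodcoef_deg1S N k : (0 < k)%N ->
  prodcoef R N.+1 k 1 = prodcoef R N k 1 + acoef R k N.+1.
Proof.
move=> k0 /=; congr (_ + _).
rewrite big_nat_recr//= subnn prodcoef_deg0 mulr1 big_nat big1 ?add0r// => j /andP[_ jk].
by rewrite prodcoef_deg0 subn_eq0 leqNgt jk mulr0.
Qed.

(** The sum of 1/(q (q+1)) telescopes to 1. *)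
Lemma limcoef_1_1 : limcoef R 1 1 = 2^-1.
Proof.
apply: cvg_lim; first exact: Rhausdorff.
rewrite (_ : (fun N => _) = fun N => 2^-1 * (1 - N.+1%:R^-1)); last first.
  apply/funext; elim=> [|N IH]; first by rewrite invr1 subrr mulr0.
  rewrite prodcoef_deg1S// IH /acoef expr1.
  have h1 : N.+1%:R != 0 :> R by rewrite pnatr_eq0.
  have h2 : 1 + N.+1%:R != 0 :> R by rewrite addrC natr1 pnatr_eq0.
  have -> : 2`!%:R = 2 :> R by [].
  rewrite -[N.+2%:R]nat1r; field.
  by rewrite !nat1r !pnatr_eq0.
have H : (1 - N.+1%:R^-1 @[N --> \oo] --> (1 - 0 : R))%classic.
  exact: (cvgB (cvg_cst _) (@cvg_harmonic R)).
rewrite [X in (_ --> X)%classic](_ : _ = 2^-1 * (1 - 0)); last by rewrite subr0 mulr1.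
exact: (cvgM (cvg_cst _) H).
Qed.

(** Summing 1/(q^(k+1) (q+1)) + 1/(q^k (q+1)) = 1/q^(k+1) over q; the
    factorials undo those in a_k(q). *)
Lemma zeta_limcoef k : (0 < k)%N ->
  zeta R k.+1 = k.+2`!%:R * limcoef R k.+1 1 + k.+1`!%:R * limcoef R k 1.
Proof.
move=> k0; apply: cvg_lim; first exact: Rhausdorff.
rewrite (_ : series _ =
  fun N => k.+2`!%:R * prodcoef R N k.+1 1 + k.+1`!%:R * prodcoef R N k 1); last first.
  apply/funext; elim=> [|N IH]; first by rewrite /series/= big_geq// andbF !mulr0 addr0.
  rewrite !prodcoef_deg1S// /series/= big_nat_recr//= -[\sum_(_ <= _ < _) _]/(series _ N) IH.
  have h1 : N.+1%:R != 0 :> R by rewrite pnatr_eq0.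
  have h2 : N.+1%:R + 1 != 0 :> R by rewrite natr1 pnatr_eq0.
  have h3 : N.+1%:R ^+ k != 0 :> R by rewrite expf_neq0.
  have h4 m : m`!%:R != 0 :> R by rewrite pnatr_eq0 -lt0n fact_gt0.
  rewrite !mulrDr addrACA; congr (_ + _).
  rewrite /acoef !invfM !mulrA !divff// !mul1r -[N.+2%:R]natr1 exprS.
  field.
  by rewrite !nat1r h1 h2 h3.
by apply: cvgD; apply: (cvgM (cvg_cst _)); exact: cvg_prodcoef.
Qed.

Lemma limcoef_rho r : (2 <= r)%N -> limcoef R r.-1 1 = rho R r.
Proof.
case: r => [|[|n]]// _.
suff H : n.+2`!%:R * limcoef R n.+1 1 =
    (-1) ^+ n.+2 + \sum_(3 <= j < n.+3) (-1) ^+ (n.+2 + j) * zeta R j.-1.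
  by rewrite /rho -H mulKf// pnatr_eq0 -lt0n fact_gt0.
elim: n => [|n IH].
  rewrite big_geq// addr0 limcoef_1_1 sqrrN expr1n.
  by have -> : 2`!%:R = 2 :> R by []; rewrite divff.
have := zeta_limcoef (ltn0Sn n); rewrite IH => /eqP; rewrite -subr_eq => /eqP <-.
rewrite [X in _ = _ + X]big_nat_recr//= addrA [RHS]addrC.
rewrite (_ : (-1) ^+ (n.+3 + n.+3) = 1); last by rewrite addnn -mul2n exprM sqrrN !expr1n.
rewrite mul1r; congr (_ + _).
rewrite opprD [(-1) ^+ n.+3]exprS mulN1r; congr (_ + _).
rewrite -sumrN; apply: eq_bigr => j _.
by rewrite [in RHS]addSn [in RHS]exprS mulN1r mulNr.
Qed.
End Rho.

(** * Sums over partitions *)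

Section Partitions.
Variable R : realType.
Implicit Types (nu mu X t : seq nat).

(** Sum of prod_s a_(nu_s)(q_s) over pairwise distinct q_s in [1, N] avoiding
    X; the list X collects the values taken at earlier positions. *)
Fixpoint injsum (N : nat) X nu : R :=
  if nu is k :: nu' then
    \sum_(1 <= q < N.+1 | q \notin X) acoef R k q * injsum N (q :: X) nu'
  else 1.

Lemma injsum_avoid N X Y nu :
  (forall q, (1 <= q <= N)%N -> (q \in X) = (q \in Y)) ->
  injsum N X nu = injsum N Y nu.
Proof.
elim: nu X Y => //= k nu IH X Y XY.
rewrite big_nat_cond [RHS]big_nat_cond; apply: eq_big => q.
  by case: (boolP (1 <= q < N.+1)%N) => //= qN; rewrite XY.
move=> _; congr (_ * _); apply: IH => p pN.
by rewrite !inE XY.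
Qed.

Definition del s nu : seq nat := take s nu ++ drop s.+1 nu.

(** Either the value N + 1 is not taken, or it is taken at exactly one
    position s. *)
Lemma injsumS N X nu : N.+1 \notin X ->
  injsum N.+1 X nu = injsum N X nu +
    \sum_(0 <= s < size nu) acoef R (nth 0%N nu s) N.+1 * injsum N X (del s nu).
Proof.
elim: nu X => [|k nu IH] X NX; first by rewrite big_geq// addr0.
rewrite [size _]/= big_nat_recl//= big_mkcond big_nat_recr//= -big_mkcond NX.
rewrite /del /= drop0.
(* Once N + 1 is excluded, the sum ranges over [1, N] again. *)
have -> : injsum N.+1 (N.+1 :: X) nu = injsum N X nu.
  have aux : forall Y, N.+1 \in Y -> injsum N.+1 Y nu = injsum N Y nu.
    elim: nu {IH} => //= j nu IH Y NY.
    rewrite big_mkcond big_nat_recr//= -big_mkcond NY addr0.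
    by apply: eq_bigr => q _; rewrite IH// inE NY orbT.
  rewrite aux ?mem_head//; apply: injsum_avoid => q /andP[_ qN].
  by rewrite inE; case: eqP => // qE; move: qN; rewrite qE ltnn.
rewrite [RHS]addrCA [LHS]addrC; congr (_ + _).
under [in X in _ = _ + X]eq_bigr do rewrite mulr_sumr.
rewrite exchange_big /= -big_split /= big_nat_cond [RHS]big_nat_cond.
apply: eq_bigr => q /andP[/andP[q1 qN] qX].
rewrite IH ?inE ?negb_or ?NX ?andbT; last by rewrite neq_ltn (leq_trans qN) ?orbT.
rewrite mulrDr mulr_sumr; congr (_ + _).
by apply: eq_bigr => s _; rewrite mulrCA.
Qed.

Lemma injsum0 X nu : injsum 0 X nu = (nu == [::])%:R.
Proof. by case: nu => //= k nu; rewrite big_geq. Qed.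

Lemma perm_del s nu : (s < size nu)%N -> perm_eq (del s nu) (rem (nth 0%N nu s) nu).
Proof.
move=> sn; rewrite -(perm_cons (nth 0%N nu s)).
rewrite -(permPr (perm_to_rem (mem_nth 0%N sn))).
rewrite -[X in perm_eq _ X](cat_take_drop s) [in X in perm_eq _ X](drop_nth 0%N sn).
exact: (permEl (perm_catCA [:: nth 0%N nu s] (take s nu) (drop s.+1 nu))).
Qed.

Lemma perm_rem (x : nat) nu mu : perm_eq nu mu -> perm_eq (rem x nu) (rem x mu).
Proof.
move=> nm; apply/permP => P.
by rewrite !count_rem (permP nm) (perm_mem nm).
Qed.

(** By induction on N: deleting position s leaves a permutation of
    [rem (nu_s) nu], so the recursion only sees nu as a multiset. *)
Lemma injsum_perm N nu mu : perm_eq nu mu -> injsum N [::] nu = injsum N [::] mu.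
Proof.
elim: N nu mu => [|N IH] nu mu nm.
  by rewrite !injsum0 -!size_eq0 (perm_size nm).
rewrite !injsumS// (IH _ _ nm); congr (_ + _).
have H nu' : \sum_(0 <= s < size nu') acoef R (nth 0%N nu' s) N.+1 * injsum N [::] (del s nu')
   = \sum_(x <- nu') acoef R x N.+1 * injsum N [::] (rem x nu').
  rewrite [RHS](big_nth 0%N); apply: eq_big_nat => s /andP[_ sn].
  by rewrite (IH _ _ (perm_del sn)).
rewrite !H (perm_big _ nm); apply: eq_bigr => x _.
by rewrite (IH _ _ (perm_rem x nm)).
Qed.

(** Positions carrying equal parts contribute equally. *)
Lemma injsum_rem N nu :
  injsum N.+1 [::] nu = injsum N [::] nu +
    \sum_(j <- undup nu) (count_mem j nu)%:R * (acoef R j N.+1 * injsum N [::] (rem j nu)).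
Proof.
rewrite injsumS//; congr (_ + _).
transitivity (\sum_(x <- nu) acoef R x N.+1 * injsum N [::] (rem x nu)).
  rewrite [RHS](big_nth 0%N); apply: eq_big_nat => s /andP[_ sn].
  by rewrite (injsum_perm _ (perm_del sn)).
rewrite -big_undup_iterop_count; apply: eq_bigr => j _.
by rewrite mulr_natl.
Qed.

Definition multfact nu : nat := \prod_(j <- undup nu) (count_mem j nu)`!.

Lemma multfact_gt0 nu : (0 < multfact nu)%N.
Proof. by rewrite prodn_gt0// => j; rewrite fact_gt0. Qed.

(** Parts of multiplicity 0 contribute 0! = 1, so nu and [rem j nu] can be
    compared over the same index set. *)
Lemma multfact_wide nu X : uniq X -> {subset nu <= X} ->
  multfact nu = \prod_(j <- X) (count_mem j nu)`!.
Proof.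
move=> uX nX; rewrite -[RHS](big_rmcond_in (mem nu))/=; last first.
  by move=> j _ /count_memPn ->.
rewrite -big_filter; apply: perm_big; apply: uniq_perm; rewrite ?undup_uniq ?filter_uniq//.
by move=> j; rewrite mem_undup mem_filter; case: (boolP (j \in nu)) => //= /nX ->.
Qed.

Lemma multfact_rem j nu : j \in nu ->
  multfact nu = (count_mem j nu * multfact (rem j nu))%N.
Proof.
move=> jnu.
rewrite (@multfact_wide (rem j nu) (undup nu)) ?undup_uniq//; last first.
  by move=> x /mem_rem; rewrite mem_undup.
have ju : j \in undup nu by rewrite mem_undup.
rewrite /multfact !(bigD1_seq j)/= ?undup_uniq// mulnA; congr (_ * _)%N.
  have c0 : (0 < count_mem j nu)%N by rewrite -has_count has_pred1.
  by rewrite count_mem_rem eqxx subn1 -[in LHS](prednK c0) factS prednK.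
by apply: eq_bigr => i ij; rewrite count_mem_rem eq_sym (negPf ij) subn0.
Qed.

Definition Cnu_fin N nu : R := (multfact nu)%:R^-1 * injsum N [::] nu.

(** Normalizing by the factorials of the multiplicities cancels the
    multiplicity that [injsum_rem] attaches to each distinct part. *)
Lemma Cnu_finS N nu : Cnu_fin N.+1 nu =
  Cnu_fin N nu + \sum_(j <- undup nu) acoef R j N.+1 * Cnu_fin N (rem j nu).
Proof.
rewrite /Cnu_fin injsum_rem mulrDr; congr (_ + _).
rewrite mulr_sumr; apply: eq_big_seq => j; rewrite mem_undup => jnu.
rewrite (multfact_rem jnu) natrM.
have h1 : (multfact (rem j nu))%:R != 0 :> R by rewrite pnatr_eq0 -lt0n multfact_gt0.
have h2 : (count_mem j nu)%:R != 0 :> R by rewrite pnatr_eq0 -lt0n -has_count has_pred1.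
by field; rewrite h1 h2.
Qed.

Definition parts n d : seq (seq nat) :=
  [seq map val (tval p) | p <- enum {: d.-tuple 'I_n.+1} & is_partition n (map val (tval p))].

Lemma partition_sumE n d (F : seq nat -> R) :
  partition_sum n d F = \sum_(nu <- parts n d) F nu.
Proof. by rewrite /parts big_map big_filter big_enum_cond. Qed.

Lemma parts_uniq n d : uniq (parts n d).
Proof.
rewrite map_inj_uniq; first by rewrite filter_uniq ?enum_uniq.
by move=> s t /(inj_map val_inj) /val_inj.
Qed.

Lemma leq_sumn nu x : x \in nu -> (x <= sumn nu)%N.
Proof. by move=> /perm_to_rem/perm_sumn -> /=; exact: leq_addr. Qed.

Lemma mem_parts n d nu : (nu \in parts n d) = is_partition n nu && (size nu == d).
Proof.
apply/mapP/andP => [[t]|[pn /eqP sn]].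
  by rewrite mem_filter => /andP[H _] ->; rewrite H size_map size_tuple eqxx.
have E : map val (map (fun x => inord x : 'I_n.+1) nu) = nu.
  rewrite -map_comp -[RHS]map_id; apply/eq_in_map => x xnu /=.
  rewrite inordK// ltnS; case/and3P: pn => _ _ /eqP <-.
  exact: leq_sumn.
have S : size (map (fun x => inord x : 'I_n.+1) nu) == d by rewrite size_map sn.
exists (Tuple S) => //=.
by rewrite mem_filter mem_enum andbT /= E.
Qed.

Lemma geq_trans : transitive geq. Proof. by move=> y x z /= h1 h2; exact: leq_trans h2 h1. Qed.
Lemma geq_anti : antisymmetric geq.
Proof. by move=> x y /andP[h1 h2]; apply: anti_leq; apply/andP; split. Qed.
Lemma geq_total : total geq. Proof. by move=> x y; exact: leq_total. Qed.

(** The inverse of removing the part j is inserting it and sorting. *)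
Lemma perm_rem_parts n d j : (1 <= j <= n)%N ->
  perm_eq [seq rem j nu | nu <- parts n d.+1 & j \in nu] (parts (n - j) d).
Proof.
move=> /andP[j1 jn]; apply: uniq_perm; last 1 first.
- move=> mu; rewrite mem_parts; apply/mapP/andP => [[nu]|[/and3P[smu m0 /eqP Smu] /eqP dmu]].
    rewrite mem_filter mem_parts => /and3P[jnu /and3P[snu n0 /eqP Snu] /eqP dnu] ->.
    have := perm_to_rem jnu => pe.
    rewrite /is_partition (subseq_sorted geq_trans (rem_subseq _ _) snu).
    rewrite (contra (@mem_rem _ _ _ _) n0) /= -{1}Snu (perm_sumn pe) /= addKn eqxx.
    by split=> //; rewrite size_rem// dnu.
  have ssort := sort_sorted geq_total (j :: mu).
  have pe : perm_eq (sort geq (j :: mu)) (j :: mu) by rewrite perm_sort.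
  exists (sort geq (j :: mu)).
    rewrite mem_filter mem_parts mem_sort mem_head /is_partition ssort /=.
    rewrite mem_sort inE (negPf m0) orbF eq_sym -lt0n j1 (perm_sumn pe) /= Smu.
    by rewrite subnKC// eqxx size_sort /= dmu eqxx.
  apply: (sorted_eq geq_trans geq_anti) => //.
    by rewrite (subseq_sorted geq_trans (rem_subseq _ _)).
  by have := perm_rem j pe; rewrite /= eqxx perm_sym.
- rewrite map_inj_in_uniq ?filter_uniq ?parts_uniq// => s t.
  rewrite !mem_filter !mem_parts => /and3P[js /and3P[ss _ _] _] /and3P[jt /and3P[st _ _] _] E.
  apply: (sorted_eq geq_trans geq_anti) => //.
  by rewrite (permPl (perm_to_rem js)) E perm_sym perm_to_rem.
exact: parts_uniq.
Qed.

(** Double counting of the partitions nu with a marked distinct part j. *)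
Lemma sum_parts_rem n d (F : nat -> seq nat -> R) :
  \sum_(nu <- parts n d.+1) \sum_(j <- undup nu) F j (rem j nu) =
  \sum_(1 <= j < n.+1) \sum_(mu <- parts (n - j) d) F j mu.
Proof.
transitivity (\sum_(nu <- parts n d.+1) \sum_(1 <= j < n.+1)
    if j \in nu then F j (rem j nu) else 0).
  apply: eq_big_seq => nu; rewrite mem_parts => /andP[/and3P[_ n0 /eqP Sn] _].
  rewrite -big_mkcond -big_filter; apply: perm_big; apply: uniq_perm.
  - exact: undup_uniq.
  - by rewrite filter_uniq// iota_uniq.
  move=> j; rewrite mem_undup mem_filter mem_index_iota.
  case: (boolP (j \in nu)) => //= jnu; rewrite ltnS -Sn leq_sumn// andbT lt0n.
  by apply/esym; apply: contraNneq n0 => <-.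
rewrite exchange_big; apply: eq_big_nat => j jn.
rewrite -(perm_big _ (perm_rem_parts d _)) //= big_map big_filter.
by rewrite -big_mkcond.
Qed.

(** Both sides obey the same recursion in N: the part j removed from nu is
    the power of u supplied by the last factor. *)
Lemma prodcoef_parts N n d : prodcoef R N n d = \sum_(nu <- parts n d) Cnu_fin N nu.
Proof.
elim: N n d => [|N IH] n d.
  rewrite /=; have [/andP[/eqP -> /eqP ->]|nd] := boolP ((n == 0%N) && (d == 0%N)).
    rewrite (_ : parts 0 0 = [:: [::]]) ?big_seq1.
      by rewrite /Cnu_fin /multfact big_nil invr1 mul1r.
    apply: perm_small_eq => //; apply: uniq_perm; rewrite ?parts_uniq//.
    by move=> nu; rewrite mem_parts inE; case: nu => //= x nu; rewrite andbF.
  rewrite big1_seq// => nu; rewrite mem_parts => /andP[_ /andP[/and3P[_ _ /eqP Sn] /eqP sn]].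
  rewrite /Cnu_fin injsum0; case: nu Sn sn => [/= Sn sn|x nu _ _]; last by rewrite /= mulr0n mulr0.
  by move: nd; rewrite -Sn -sn.
under eq_bigr do rewrite Cnu_finS.
rewrite big_split /= -IH; congr (_ + _).
case: d => [|d].
  rewrite big1_seq// => nu; rewrite mem_parts => /andP[_ /andP[_ /nilP ->]].
  by rewrite big_nil.
rewrite (sum_parts_rem n d (fun j mu => acoef R j N.+1 * Cnu_fin N mu)); apply: eq_bigr => j _.
by rewrite IH mulr_sumr.
Qed.
End Partitions.

Section CnuLimit.
Variable R : realType.
Implicit Types (nu X t : seq nat).

(** The tuples over which [injsum] sums, listed without repetition. *)
Fixpoint injs (N : nat) X d : seq (seq nat) :=
  if d is d'.+1 then
    [seq q :: t | q <- [seq q <- index_iota 1 N.+1 | q \notin X], t <- injs N (q :: X) d']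
  else [:: [::]].

Definition wordprod nu t : R := \prod_(s < size nu) acoef R (nth 0%N nu s) (nth 0%N t s).

Lemma injsumE N X nu :
  injsum R N X nu = \sum_(t <- injs N X (size nu)) wordprod nu t.
Proof.
elim: nu X => [|k nu IH] X /=; first by rewrite big_seq1 /wordprod big_ord0.
rewrite big_allpairs_dep big_filter /=; apply: eq_bigr => q _.
rewrite IH mulr_sumr; apply: eq_bigr => t _.
by rewrite /wordprod big_ord_recl.
Qed.

Lemma mem_injs N X d t : (t \in injs N X d) =
  [&& size t == d, uniq t, all (fun q => 1 <= q <= N)%N t & all [predC X] t].
Proof.
elim: d X t => [|d IH] X t; first by rewrite /= inE; case: t.
apply/allpairsPdep/idP => [[q [t' [+ + ->]]]|].
  rewrite mem_filter mem_index_iota ltnS IH /= => /andP[qX ->] /and4P[/eqP -> -> -> H].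
  rewrite eqxx qX /= andbT; apply/andP; split.
    by apply/negP => /(allP H); rewrite /= inE eqxx.
  by apply: sub_all H => x /=; rewrite inE negb_or => /andP[].
case: t => [//|q t] /=; rewrite eqSS => /and4P[/eqP td /andP[qt ut] /andP[qN tN] /andP[qX tX]].
exists q, t; split=> //; first by rewrite mem_filter qX mem_index_iota ltnS.
rewrite IH td eqxx ut tN /=; apply/allP => x xt /=.
have /= xX := allP tX x xt; rewrite inE negb_or xX andbT.
by apply: contraNneq qt => <-.
Qed.

Lemma injs_uniq N X d : uniq (injs N X d).
Proof.
elim: d X => //= d IH X; apply: allpairs_uniq_dep.
- by rewrite filter_uniq// iota_uniq.
- by move=> q _; exact: IH.
by move=> [x s] [y t] _ _ /= [-> ->].
Qed.

Lemma wordprod_ge0 nu t : 0 <= wordprod nu t.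
Proof. by apply: prodr_ge0 => s _; exact: acoef_ge0. Qed.

Lemma ler_sum_subseq (T : eqType) (s1 s2 : seq T) (F : T -> R) :
  uniq s1 -> uniq s2 -> {subset s1 <= s2} -> (forall x, 0 <= F x) ->
  \sum_(x <- s1) F x <= \sum_(x <- s2) F x.
Proof.
move=> u1 u2 s12 F0.
have pe : perm_eq [seq x <- s2 | x \in s1] s1.
  apply: uniq_perm; rewrite ?filter_uniq// => x.
  by rewrite mem_filter; case: (boolP (x \in s1)) => //= /s12.
rewrite [leRHS](bigID (mem s1))/= -[X in _ <= X + _]big_filter (perm_big _ pe).
by rewrite lerDl sumr_ge0.
Qed.

Definition injtuples N d : seq (d.-tuple nat) := pmap insub (injs N [::] d).

Lemma mem_injtuples N d (q : d.-tuple nat) : (q \in injtuples N d) =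
  uniq q && all (fun x => 1 <= x <= N)%N q.
Proof.
rewrite /injtuples mem_pmap_sub mem_injs size_tuple eqxx /=.
by rewrite (_ : all [predC [::]] q) ?andbT//; apply/allP.
Qed.

Lemma injtuples_uniq N d : uniq (injtuples N d).
Proof. by rewrite pmap_sub_uniq// injs_uniq. Qed.

Lemma injsum_tuples N nu : injsum R N [::] nu =
  \sum_(q <- injtuples N (size nu)) wordprod nu q.
Proof.
rewrite injsumE -(big_map val xpredT (wordprod nu)) /injtuples.
rewrite (pmap_filter (insubK _)) (@eq_in_filter _ _ predT) ?filter_predT// => t.
by rewrite mem_injs isSome_insub => /and4P[].
Qed.

(** The partial sums are nonnegative finite subsums that eventually contain
    any given finite set of tuples. *)
Lemma cvg_injsum nu : 0%N \notin nu ->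
  (injsum R N [::] nu @[N --> \oo] --> fine (Cnu_sum R nu))%classic.
Proof.
move=> nu0; have fin := Cnu_sum_fin_num R nu0.
have Cw (q : (size nu).-tuple nat) :
    \prod_(s < size nu) acoef R (nth 0%N nu s) (tnth q s) = wordprod nu q.
  by apply: eq_bigr => s _; rewrite (tnth_nth 0%N).
have le_C N : injsum R N [::] nu <= fine (Cnu_sum R nu).
  rewrite -lee_fin fineK//; apply: esum_ge.
  exists [set` injtuples N (size nu)]%classic.
    split; first exact: finite_seq.
    move=> q /=; rewrite mem_injtuples => /andP[uq qN]; split=> // s.
    by have /andP[] := allP qN _ (mem_tnth s q).
  rewrite -fsbig_seq ?injtuples_uniq// sumEFin lee_fin injsum_tuples.
  by under [leRHS]eq_bigr do rewrite Cw.
apply/cvgrPdist_le => e e0.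
have [_ [A [finA sA] <-] HA] := ub_ereal_sup_adherent e0 fin.
pose r := finmap.enum_fset (fset_set A).
(* N0 bounds all entries of the finitely many tuples in A. *)
pose N0 := (\max_(q <- r) \max_(s < size nu) tnth q s)%N.
exists N0 => // N /= N0N.
rewrite ger0_norm ?subr_ge0// lerBlDr -lerBlDl -lee_fin EFinB fineK//.
apply: (le_trans (ltW HA)).
rewrite fsbig_finite// sumEFin lee_fin injsum_tuples.
under eq_bigr do rewrite Cw.
apply: ler_sum_subseq; rewrite ?finmap.fset_uniq ?injtuples_uniq//; last first.
  by move=> q; exact: wordprod_ge0.
move=> q qA; have : q \in fset_set A by [].
rewrite in_fset_set// inE => /sA [uq q1].
rewrite mem_injtuples uq /=; apply/allP => _ /tnthP[s ->]; rewrite q1 /=.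
apply: leq_trans N0N; rewrite /N0 (big_rem q)//=.
by rewrite (leq_trans _ (leq_maxl _ _))// (leq_bigmax s).
Qed.

Lemma limcoef_partition_sum n d : limcoef R n d = partition_sum n d (Cnu R).
Proof.
rewrite partition_sumE; apply: cvg_lim; first exact: Rhausdorff.
under eq_fun do rewrite prodcoef_parts.
apply: cvg_fsum => nu; rewrite mem_parts => /andP[/and3P[_ nu0 _] _].
by apply: (cvgM (cvg_cst _)); exact: cvg_injsum.
Qed.
End CnuLimit.

(** * The graded constants *)

Theorem proposition5p3 (R : realType) :
  [/\ forall r d : nat, (2 <= r)%N -> (1 <= d <= r.-1)%N ->
        Crd R r d = toC (partition_sum r.-1 d (Cnu R)),
      forall r : nat, (2 <= r)%N ->
        Cr R r = \sum_(1 <= d < r) Crd R r d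
    & forall r : nat, (2 <= r)%N -> Crd R r 1 = toC (rho R r)].
Proof.
split=> [r d _ _|r|r r2]; first by rewrite Crd_limcoef limcoef_partition_sum.
  exact: Cr_sum.
by rewrite Crd_limcoef limcoef_rho.
Qed.
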